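(* Let $X_1,\ldots,X_n$ be i.i.d. from $P_\theta$, where the scalar-parameter model $\{P_\theta\}$ is differentiable in quadratic mean at $\theta=0$ with Fisher information $0<I_0<\infty$ at $0$. Fix $\varepsilon\in(0,1)$. For $\Delta_n>0$ put $\lambda_n=\sqrt{nI_0}\,\Delta_n$, $\mathcal R_n=[-\Delta_n,\Delta_n]$, $\mathcal N_n(\varepsilon)=\{\theta:|\theta|\le(1-\varepsilon)\Delta_n\}$, $\mathcal M_n(\varepsilon)=\{\theta:|\theta|\ge(1+\varepsilon)\Delta_n\}$ and $$R_n^*=\inf_{\phi_n}\Big\{\sup_{\theta\in\mathcal N_n(\varepsilon)}E_\theta\phi_n+\sup_{\theta\in\mathcal M_n(\varepsilon)}E_\theta(1-\phi_n)\Big\},$$ the infimum being over measurable $\phi_n=\phi_n(X_1,\ldots,X_n)\in[0,1]$. Let $\Delta_n=dn^{-\gamma}$ with $d>0$. Then $\lambda_n\asymp n^{1/2-\gamma}$ (and likewise $\Delta_n/s_n\asymp n^{1/2-\gamma}$ for any scale $s_n\asymp n^{-1/2}$), and: (i) (impossibility) if $\gamma>1/2$, then $R_n^*\to1$; (ii) (nondegenerate local regime) if $\gamma=1/2$, then $\lambda_n$ converges to a limit $\kappa=d\sqrt{I_0}\in(0,\infty)$ and $\liminf_n R_n^*\ge2\{1-\Phi(\varepsilon\kappa)\}>0$, so the classes cannot be classified consistently; (iii) (consistent resolvability) if $\gamma<1/2$ and there are an estimator $\hat\theta_n$ and a deterministic positive scale $s_n\downarrow0$ with $s_n\asymp n^{-1/2}$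 such that $$\lim_{M\to\infty}\limsup_{n\to\infty}\sup_{\theta\in\mathcal N_n(\varepsilon)\cup\mathcal M_n(\varepsilon)}P_\theta\bigl(|\hat\theta_n-\theta|>Ms_n\bigr)=0,$$ then for every fixed $0\le c<\infty$ the interval $C_n=[\hat\theta_n-cs_n,\hat\theta_n+cs_n]$ satisfies $$\inf_{\theta\in\mathcal N_n(\varepsilon)}P_\theta(C_n\subset\mathcal R_n)\to1\quad\text{and}\quad\inf_{\theta\in\mathcal M_n(\varepsilon)}P_\theta(C_n\cap\mathcal R_n=\emptyset)\to1.$$ Likewise, for a general positive sequence $\Delta_n$: if $\Delta_n=o(n^{-1/2})$ then $R_n^*\to1$; if $\Delta_n\asymp n^{-1/2}$ then $\lambda_n$ stays bounded away from $0$ and $\infty$ and $\liminf_nR_n^*>0$; and if $\sqrt n\,\Delta_n\to\infty$ and $\hat\theta_n$, $s_n$ are as in (iii), then the conclusion of (iii) holds.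
   Context: $\Phi$ is the standard normal distribution function; $x_n\asymp y_n$ means that $x_n/y_n$ is bounded away from $0$ and $\infty$. The model is indexed by a real parameter set containing a neighborhood of $0$, and $\mathcal N_n(\varepsilon)$, $\mathcal M_n(\varepsilon)$ are subsets of that parameter set (an infimum over an empty class is taken to be $1$ and a supremum over an empty class to be $0$). $P_\theta$, $E_\theta$ for events and functions of the sample refer to $X_1,\ldots,X_n$ i.i.d. $P_\theta$. Differentiability in quadratic mean at $0$: with densities $p_\theta$ with respect to dominating measures, there is a score function $\dot\ell$ with $\int(\sqrt{p_h}-\sqrt{p_0}-\tfrac12 h\dot\ell\sqrt{p_0})^2=o(h^2)$ as $h\to0$, and $I_0=E_{P_0}\dot\ell^2$. *)

(* Defs.v *)
From HB Require Import structures.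
From mathcomp Require Import all_boot all_order all_algebra.
From mathcomp Require Import all_classical all_reals all_analysis.

Set Implicit Arguments.
Unset Strict Implicit.
Unset Printing Implicit Defensive.

Import Order.TTheory GRing.Theory Num.Theory.
Import numFieldNormedType.Exports.

Local Open Scope classical_set_scope.
Local Open Scope ring_scope.

Section iid.
Context (d : measure_display) (X : measurableType d) (R : realType).

Definition tcons n (u : X * n.-tuple X) : n.+1.-tuple X :=
  [tuple of u.1 :: u.2].

Lemma measurable_tcons n : measurable_fun [set: X * n.-tuple X] (@tcons n).
Proof. exact: (@measurable_cons _ _ _ _ fst n snd). Qed.

HB.instance Definition _ n := @isMeasurableFun.Build _ _
  (X * n.-tuple X)%type (n.+1.-tuple X) (@tcons n) (@measurable_tcons n).

(* The n-fold product of P, i.e. the law of (X_1, ..., X_n) i.i.d. from P;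
   it is characterised on rectangles by iid_rect below. *)
Fixpoint iid (P : probability X R) n : probability (n.-tuple X) R :=
  match n with
  | 0 => dirac [tuple]
  | n'.+1 => distribution (P \x iid P n')%E (@tcons n')
  end.

Lemma iid_rect (P : probability X R) n (A : 'I_n -> set X) :
  (forall i, measurable (A i)) ->
  iid P n [set x | forall i, A i (tnth x i)] = (\prod_(i < n) P (A i))%E.
Proof.
elim: n A => [|n IH] A mA.
  rewrite big_ord0 /= diracE mem_set//; by case.
rewrite big_ord_recl /= /distribution /pushforward.
have -> : @tcons n @^-1` [set x | forall i, A i (tnth x i)] =
    A ord0 `*` [set x : n.-tuple X | forall i, A (lift ord0 i) (tnth x i)].
  apply/seteqP; split=> [[x t] /= h|[x t] /= [h0 h] i].
    split; first exact: (h ord0).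
    by move=> i; have := h (lift ord0 i); rewrite tnthS.
  by case: (unliftP ord0 i) => [j ->|->//]; rewrite tnthS.
rewrite product_measure1E//; last first.
  have -> : [set x : n.-tuple X | forall i, A (lift ord0 i) (tnth x i)] =
      \big[setI/setT]_(i < n) ((@tnth _ _ ^~ i) @^-1` A (lift ord0 i)).
    rewrite -bigcap_seq; apply/seteqP; split=> x /= h i; first by move=> _; exact: h.
    by apply: h => /=; exact: mem_index_enum.
  apply: bigsetI_measurable => i _; rewrite -[X in measurable X]setTI.
  exact: measurable_tnth.
congr (_ * _)%E; exact: (IH (fun i => A (lift ord0 i))).
Qed.

End iid.

Section model.
Context (d : measure_display) (X : measurableType d) (R : realType).

Definition is_density (mu : set X -> \bar R) (P : probability X R)
    (p : X -> R) : Prop :=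
  [/\ measurable_fun setT p, (forall x, 0 <= p x) &
      forall A, measurable A -> P A = (\int[mu]_(x in A) (p x)%:E)%E].

(* Differentiability in quadratic mean at 0 of (P h), h in Theta, with score
   function [score]. The model need not be dominated by a single measure: for
   each h, [p0 h] and [p1 h] are densities of P 0 and P h with respect to a
   measure [mu h] dominating both; the integral does not depend on the choice
   of [mu h]. Values of [P] outside [Theta] are irrelevant when Theta is a
   neighborhood of 0. *)
Definition dqm0 (Theta : set R) (P : R -> probability X R) (score : X -> R)
    : Prop :=
  measurable_fun setT score /\
  exists (mu : R -> {sigma_finite_measure set X -> \bar R}) (p0 p1 : R -> X -> R),
    (forall h, Theta h ->
      is_density (mu h) (P 0) (p0 h) /\ is_density (mu h) (P h) (p1 h)) /\
    ((\int[mu h]_x ((Num.sqrt (p1 h x) - Num.sqrt (p0 h x)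
                     - 2^-1 * h * score x * Num.sqrt (p0 h x)) ^+ 2)%:E)
       * (h ^- 2)%:E)%E @[h --> 0^'] --> 0%E.

Definition fisher_information (P0 : probability X R) (score : X -> R) : \bar R :=
  (\int[P0]_x ((score x) ^+ 2)%:E)%E.

(* Infimum and supremum of a [0, 1]-valued quantity over a class of parameters,
   with the conventions inf = 1 and sup = 0 for the empty class. *)
Definition inf_class (A : set R) (f : R -> \bar R) : \bar R :=
  if A == set0 then 1%E else ereal_inf [set f t | t in A].

Definition sup_class (A : set R) (f : R -> \bar R) : \bar R :=
  if A == set0 then 0%E else ereal_sup [set f t | t in A].

Definition null_class (Theta : set R) (eps Delta : R) : set R :=
  [set theta | Theta theta /\ `|theta| <= (1 - eps) * Delta].

Definition alt_class (Theta : set R) (eps Delta : R) : set R :=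
  [set theta | Theta theta /\ (1 + eps) * Delta <= `|theta|].

Definition is_test n (phi : n.-tuple X -> R) : Prop :=
  measurable_fun setT phi /\ forall x, 0 <= phi x <= 1.

Definition test_risk (Theta : set R) (P : R -> probability X R) (eps Delta : R)
    n (phi : n.-tuple X -> R) : \bar R :=
  (sup_class (null_class Theta eps Delta)
     (fun theta => \int[iid (P theta) n]_x (phi x)%:E)
   + sup_class (alt_class Theta eps Delta)
     (fun theta => \int[iid (P theta) n]_x (1 - phi x)%:E))%E.

Definition minimax_risk (Theta : set R) (P : R -> probability X R)
    (eps : R) (Delta : nat -> R) (n : nat) : \bar R :=
  ereal_inf [set test_risk Theta P eps (Delta n) phi
            | phi in [set phi : n.-tuple X -> R | is_test phi]].

Definition consistently_classifiable (Theta : set R) (P : R -> probability X R)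
    (eps : R) (Delta : nat -> R) : Prop :=
  exists phi : forall n, n.-tuple X -> R,
    (forall n, is_test (phi n)) /\
    test_risk Theta P eps (Delta n) (phi n) @[n --> \oo] --> 0%E.

(* x_n / y_n is bounded away from 0 and infinity; sequences start at n = 1. *)
Definition asymp (x y : nat -> R) : Prop :=
  exists a b : R, [/\ 0 < a, 0 < b &
    forall n, (0 < n)%N -> a <= x n / y n <= b].

Definition npow (a : R) (n : nat) : R := n%:R `^ a.

Definition lambda (I0 : R) (Delta : nat -> R) (n : nat) : R :=
  Num.sqrt (n%:R * I0) * Delta n.

Definition is_estimator (T : forall n, n.-tuple X -> R) : Prop :=
  forall n, measurable_fun setT (T n).

Definition is_root_n_scale (s : nat -> R) : Prop :=
  [/\ forall n, (0 < n)%N -> 0 < s n,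
      forall m n, (0 < m <= n)%N -> s n <= s m,
      s n @[n --> \oo] --> 0 &
      asymp s (npow (- 2^-1))].

Definition uniformly_tight_at_scale (Theta : set R) (P : R -> probability X R)
    (eps : R) (Delta : nat -> R) (T : forall n, n.-tuple X -> R)
    (s : nat -> R) : Prop :=
  limn_esup (fun n => sup_class
      (null_class Theta eps (Delta n) `|` alt_class Theta eps (Delta n))
      (fun theta => iid (P theta) n [set x | M * s n < `|T n x - theta|]))
    @[M --> +oo] --> 0%E.

Definition region (Delta : R) : set R := `[- Delta, Delta].

Definition conf_itv (T : forall n, n.-tuple X -> R) (s : nat -> R) (c : R)
    (n : nat) (x : n.-tuple X) : set R :=
  `[T n x - c * s n, T n x + c * s n].

Definition resolves (Theta : set R) (P : R -> probability X R) (eps : R)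
    (Delta : nat -> R) (T : forall n, n.-tuple X -> R) (s : nat -> R) (c : R)
    : Prop :=
  inf_class (null_class Theta eps (Delta n))
    (fun theta => iid (P theta) n
       [set x | conf_itv T s c x `<=` region (Delta n)])
    @[n --> \oo] --> 1%E /\
  inf_class (alt_class Theta eps (Delta n))
    (fun theta => iid (P theta) n
       [set x | conf_itv T s c x `&` region (Delta n) = set0])
    @[n --> \oo] --> 1%E.

End model.

Definition Phi (R : realType) (x : R) : \bar R :=
  normal_prob (0 : R) 1 `]-oo, x].

(* Main.v *)
(* The minimax risk dominates the risk of testing theta0 = (1 - eps) Delta
   against theta1 = (1 + eps) Delta, which is bounded below without a central
   limit theorem. Let F_n(a, b) be the infimum over tests phi of
   a E_theta0 phi + b E_theta1 (1 - phi). With r, r' the densities of P_theta0,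
   P_theta1 with respect to P_0, conditioning on the first observation gives
   F_{n+1}(a, b) >= int F_n(a r, b r') dP_0, and F_0(a, b) = min(a, b). The
   overlap w_s(a, b) = int min(a phi(z), b phi(z - s)) dz of two Gaussian
   densities solves the matching heat equation (it is the Black-Scholes
   formula), and w_s <= min(a, b). A second-order Taylor expansion of w_s,
   uniform in (a, b) by homogeneity as long as s >= s0 > 0, shows that
   w_{sqrt(s0^2 + n tau)}(a, b) - n c (a + b) <= F_n(a, b), provided that tau
   bounds E_0 (r' - r)^2 near r = r' = 1. Differentiability in quadratic mean
   allows n tau -> lim n (theta1 - theta0)^2 I0 with n c -> 0, and s0 -> 0
   afterwards. Since w_s(1, 1) = 2 (1 - Phi(s / 2)), this single inequality
   covers the impossibility and the local regimes; the resolvable regime is the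
   triangle inequality. *)
Require Import Defs.
From HB Require Import structures.
From mathcomp Require Import all_boot all_order all_algebra.
From mathcomp Require Import all_classical all_reals all_analysis.
From mathcomp Require Import measurable_realfun random_variable.
From mathcomp Require Import ring lra.

Set Implicit Arguments.
Unset Strict Implicit.
Unset Printing Implicit Defensive.

Import Order.TTheory GRing.Theory Num.Theory.
Import numFieldNormedType.Exports.

Local Open Scope classical_set_scope.
Local Open Scope ring_scope.

(** * The Gaussian overlap *)

Section gauss.
Context {R : realType}.
Implicit Types x y : R.

(** The function min(a, b) has a kink at a = b and admits no second-order expansion there. Starting
    the recursion from the smoothed minorant [overlap s0] makes the expansion available at every
    step, at the price of an additional variance s0^2. The remainders must be uniform in the weights
    because after some observations these have become arbitrary likelihoods.

    The expansion is usable only where both ratios are near 1. Elsewhere the risk is nonnegative and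
    is dropped, so the mass lost there must be o(1/n) per observation. Chebyshev alone gives O(1/n);
    the gain comes from truncating the square-integrable score.

    The error is kept proportional to a + b because the P_0-averages of r and r' are at most 1, so
    it does not grow when the weights are updated. Since n (theta1 - theta0)^2 I0 = 4 eps^2
    lambda_n^2, the argument s / 2 ends up near eps lambda_n, which is where the constant eps kappa
    comes from. *)

Definition gpdf x : R := normal_pdf 0 1 x.
Definition gcdf x : R := fine (Phi x).

Lemma Phi_gcdf x : Phi x = (gcdf x)%:E.
Proof. by rewrite /gcdf fineK// fin_num_measure. Qed.

Lemma gcdf_ge0 x : 0 <= gcdf x.
Proof. by rewrite -lee_fin -Phi_gcdf. Qed.

Lemma gcdf_le1 x : gcdf x <= 1.
Proof. by rewrite -lee_fin -Phi_gcdf /Phi probability_le1. Qed.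

Lemma gpdfE x : gpdf x = (Num.sqrt (pi *+ 2))^-1 * expR (- (x ^+ 2) / 2).
Proof.
by rewrite /gpdf normal_pdfE ?oner_neq0// /normal_peak /normal_fun subr0 expr1n mul1r.
Qed.

Lemma gpdf_gt0 x : 0 < gpdf x.
Proof. by rewrite gpdfE mulr_gt0 ?expR_gt0// invr_gt0 sqrtr_gt0 mulrn_wgt0// pi_gt0. Qed.

Lemma gpdfN x : gpdf (- x) = gpdf x.
Proof. by rewrite !gpdfE sqrrN. Qed.

Lemma is_derive_gcdf x : is_derive x 1 gcdf (gpdf x).
Proof.
have ig : (@lebesgue_measure R).-integrable `]-oo, x + 1] (EFin \o gpdf).
  apply: integrableS (@integrable_normal_pdf R 0 1) => //.
have cf : {for x, continuous gpdf}.
  by apply: continuous_normal_pdf; rewrite oner_neq0.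
have xx1 : x < x + 1 by rewrite ltrDl.
have [|d1 d2] := continuous_FTC1 xx1 ig _ cf; first exact: ltNyr.
by split; [exact: d1|rewrite -derive1E; exact: d2].
Qed.

Lemma gcdfN x : gcdf (- x) = 1 - gcdf x.
Proof.
suff : Phi (- x) = (1 - Phi x)%E.
  by rewrite !Phi_gcdf => -[].
rewrite /Phi -probability_setC ?setCitvl; last exact: measurable_itv.
rewrite /= /normal_prob.
rewrite integral_itv_obnd_cbnd//; last first.
  by apply/measurable_EFinP; apply: measurable_funTS; exact: measurable_normal_pdf.
rewrite ge0_integration_by_substitutionNy//.
- by apply: eq_integral => y _ /=; congr EFin; exact: gpdfN.
- by apply/continuous_subspaceT; apply: continuous_normal_pdf; rewrite oner_neq0.
- by move=> y _; exact: normal_pdf_ge0.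
Qed.

Lemma continuous_gcdf : continuous gcdf.
Proof.
move=> x; apply/differentiable_continuous/derivable1_diffP.
by have := is_derive_gcdf x.
Qed.

Lemma gcdf_lt x y : x < y -> gcdf x < gcdf y.
Proof.
move=> xy; rewrite -subr_gt0.
have [z _||c _ ->] := @MVT _ gcdf gpdf _ _ xy.
- exact: is_derive_gcdf.
- exact/continuous_subspaceT/continuous_gcdf.
- by rewrite mulr_gt0 ?gpdf_gt0// subr_gt0.
Qed.

Lemma gcdf0 : gcdf 0 = 2^-1.
Proof. by have := gcdfN 0; rewrite oppr0; lra. Qed.

Lemma gcdf_lt1 x : gcdf x < 1.
Proof. by apply: lt_le_trans (gcdf_le1 (x + 1)); apply: gcdf_lt; rewrite ltrDl. Qed.

Let idTR : measurableTypeR R -> R := idfun.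

#[local] HB.instance Definition _ :=
  @isMeasurableFun.Build _ _ _ _ idTR (@measurable_id _ _ setT).

Lemma cvg_gcdfNy : gcdf x @[x --> -oo] --> 0.
Proof.
have := @cvg_cdfNy0 _ _ _ (normal_prob (0 : R) 1) idTR.
by move=> /fine_cvgP[_].
Qed.

End gauss.

(** * Closed form of the overlap and its derivatives *)

Section gaussian_overlap.
Context {R : realType}.
Implicit Types x y s l : R.

Lemma sqrt_2pi_ge1 : 1 <= Num.sqrt (pi *+ 2) :> R.
Proof.
rewrite -[leLHS]sqrtr1 ler_sqrt; last by rewrite mulrn_wge0// pi_ge0.
by have := @pi_ge2 R; rewrite mulr2n; lra.
Qed.

Lemma gpdf_le1 x : gpdf x <= 1.
Proof.
rewrite gpdfE mulr_ile1 ?expR_ge0 ?invr_ge0//.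
  by rewrite invf_le1 ?sqrt_2pi_ge1// (lt_le_trans _ sqrt_2pi_ge1).
by rewrite -[leRHS]expR0 ler_expR; have := sqr_ge0 x; lra.
Qed.

Lemma is_derive_gpdf x : is_derive x 1 gpdf (- x * gpdf x).
Proof.
rewrite (_ : gpdf = (fun y => (Num.sqrt (pi *+ 2))^-1 * expR (- (y ^+ 2) / 2))); last first.
  by apply/funext => y; rewrite gpdfE.
have d1 : is_derive x 1 (fun y : R => - (y ^+ 2) / 2) (- x).
  apply: is_derive_eq; rewrite /GRing.scale/=; lra.
have d2 := @is_derive1_comp _ expR (fun y => - (y ^+ 2) / 2) _ _ _ (is_derive_expR _) d1.
have d3 := is_deriveZ (Num.sqrt (pi *+ 2))^-1 d2.
apply: is_derive_eq.
by rewrite /GRing.scale/=; ring.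
Qed.

Lemma gpdf_lip x y : `|gpdf x - gpdf y| <= `|x - y|.
Proof.
wlog xy : x y / x < y.
  move=> H; have [xy|yx|->] := ltgtP x y; first exact: H.
    by rewrite distrC (distrC x); exact: H.
  by rewrite !subrr.
rewrite distrC (distrC x).
have [z _||c _ ->] := @MVT _ gpdf (fun x => - x * gpdf x) _ _ xy.
- exact: is_derive_gpdf.
- by apply/continuous_subspaceT; apply: continuous_normal_pdf; rewrite oner_neq0.
- rewrite normrM ler_piMl//.
  rewrite normrM normrN (ger0_norm (ltW (gpdf_gt0 _))).
  rewrite gpdfE mulrCA mulr_ile1 ?mulr_ge0 ?invr_ge0 ?expR_ge0//.
    by rewrite invf_le1 ?sqrt_2pi_ge1// (lt_le_trans _ sqrt_2pi_ge1).
  (* The derivative is bounded by 1 since |c| <= 1 + c^2 / 2 <= exp(c^2 / 2). *)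
  rewrite mulNr expRN ler_pdivrMr ?expR_gt0// mul1r.
  apply: le_trans (expR_ge1Dx _).
  by rewrite -real_normK ?num_real//; have := sqr_ge0 (`|c| - 1); nra.
Qed.

(* [goverlap s l] is the integral of [min(phi(z), e^l phi(z - s))], in closed
   form: it is the Black-Scholes formula. *)
Definition goverlap_arg s l := l / s - s / 2.
Definition goverlap s l := gcdf (goverlap_arg s l) + expR l * gcdf (goverlap_arg s (- l)).

(** With z = - [goverlap_arg s l] this reads e^l phi(z - s) = phi(z): the two weighted densities
    cross at z. Both derivatives of [goverlap] are short because the terms coming from the moving
    crossing point cancel by this identity. *)
Lemma gpdf_goverlap_argN s l : s != 0 ->
  expR l * gpdf (goverlap_arg s (- l)) = gpdf (goverlap_arg s l).
Proof.
move=> s0; rewrite !gpdfE mulrCA -expRD; congr (_ * expR _).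
by rewrite /goverlap_arg; field.
Qed.

Lemma is_derive_goverlap s l : s != 0 ->
  is_derive l 1 (goverlap s) (expR l * gcdf (goverlap_arg s (- l))).
Proof.
move=> s0.
have d1 : is_derive l 1 (goverlap_arg s) s^-1.
  by apply: is_derive_eq; rewrite /GRing.scale/=; lra.
have d1' : is_derive l 1 (fun l => goverlap_arg s (- l)) (- s^-1).
  by apply: is_derive_eq; rewrite /GRing.scale/=; lra.
have d2 := @is_derive1_comp _ gcdf (goverlap_arg s) _ _ _ (is_derive_gcdf _) d1.
have d3 := @is_derive1_comp _ gcdf (fun l => goverlap_arg s (- l)) _ _ _ (is_derive_gcdf _) d1'.
have d4 := is_deriveM (is_derive_expR l) d3.
have d5 := is_deriveD d2 d4.
apply: is_derive_eq.
by rewrite /GRing.scale/= -(gpdf_goverlap_argN l s0); ring.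
Qed.

(** Divided by 2 s, this is the derivative in the variance s^2. It equals half the second derivative
    at x = 0 of [goverlap s (l + ln (1 + x))], which is the heat equation behind the recursion. *)
Lemma is_derive_goverlap_shift s l : s != 0 ->
  is_derive s 1 (fun s => goverlap s l) (- gpdf (goverlap_arg s l)).
Proof.
move=> s0.

have d0 : is_derive s 1 (fun s : R => s^-1) (- s ^- 2).
  by have := @is_deriveV R id s 1 1 s0 (is_derive_id _ _); rewrite /GRing.scale/= mulr1.
have d1 : is_derive s 1 (fun s => goverlap_arg s l) (- l / s ^+ 2 - 2^-1).
  have -> : - l / s ^+ 2 - 2^-1 = l *: (- s ^- 2) - 2^-1 *: (1 : R).
    by rewrite /GRing.scale/=; field.
  rewrite (_ : goverlap_arg^~ l = l *: (fun s : R => s^-1) - 2^-1 *: id).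
    exact: is_deriveB.
  by apply/funext => u; rewrite /goverlap_arg [u / _]mulrC.
have d1' : is_derive s 1 (fun s => goverlap_arg s (- l)) (l / s ^+ 2 - 2^-1).
  have -> : l / s ^+ 2 - 2^-1 = (- l) *: (- s ^- 2) - 2^-1 *: (1 : R).
    by rewrite /GRing.scale/=; field.
  rewrite (_ : goverlap_arg^~ (- l) = (- l) *: (fun s : R => s^-1) - 2^-1 *: id).
    exact: is_deriveB.
  by apply/funext => u; rewrite /goverlap_arg [u / _]mulrC.
have d2 := @is_derive1_comp _ gcdf (fun s => goverlap_arg s l) _ _ _ (is_derive_gcdf _) d1.
have d3 := @is_derive1_comp _ gcdf (fun s => goverlap_arg s (- l)) _ _ _ (is_derive_gcdf _) d1'.
have d4 := is_deriveZ (expR l) d3.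
have d5 := is_deriveD d2 d4.
apply: is_derive_eq.
by rewrite /GRing.scale/= -(gpdf_goverlap_argN l s0); field.
Qed.

End gaussian_overlap.

(** * Expansions of the overlap, uniform in the log-ratio of the weights *)

Section gaussian_overlap_bounds.
Context {R : realType}.
Implicit Types x y s l : R.

(** The function p y = f y - f1 0 * y + K / 2 * y ^+ 2 has derivative f1 y - f1 0 + K * y, which is
    (f2 e + K) * y by the mean value theorem. Its sign is that of y, so p is smallest at 0. *)
Lemma taylor2_ge (f f1 f2 : R -> R) (K d x : R) :
  (forall y, `|y| <= d -> is_derive y 1 f (f1 y)) ->
  (forall y, `|y| <= d -> is_derive y 1 f1 (f2 y)) ->
  (forall y, `|y| <= d -> - K <= f2 y) ->
  `|x| <= d -> f 0 + f1 0 * x - K / 2 * x ^+ 2 <= f x.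
Proof.
move=> df df1 f2K xd.
have cont (g g1 : R -> R) : (forall y, `|y| <= d -> is_derive y 1 g (g1 y)) ->
    forall a b, `|a| <= d -> `|b| <= d -> {within `[a, b], continuous g}.
  move=> dg a b ad bd; apply: derivable_within_continuous => y.
  rewrite in_itv/= => /andP[ay yb].
  have /dg[//] : `|y| <= d.
  by move: ad bd; rewrite !ler_norml => /andP[? ?] /andP[? ?]; apply/andP; split; lra.
have d0 : 0 <= d by exact: le_trans (normr_ge0 x) xd.
have n0 : `|0 : R| <= d by rewrite normr0.
have [p [pE dp]] : exists p : R -> R,
    (forall y, p y = f y - f1 0 * y + K / 2 * y ^+ 2) /\
    (forall y, `|y| <= d -> is_derive y 1 p (f1 y - f1 0 + K * y)).
  exists (f - (f1 0 *: id) + ((K / 2) *: (id * id))); split=> [y|y yd].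
    by rewrite expr2.
  have := is_deriveD (is_deriveB (df _ yd) (is_deriveZ (f1 0) (is_derive_id y 1)))
    (is_deriveZ (K / 2) (is_deriveM (is_derive_id y 1) (is_derive_id y 1))).
  by congr is_derive; rewrite /GRing.scale/=; lra.
suff : p 0 <= p x by rewrite !pE; lra.
have sub a b c : `|a| <= d -> `|b| <= d -> c \in `]a, b[ -> `|c| <= d.
  rewrite in_itv/= => ad bd /andP[ay yb].
  by move: ad bd; rewrite !ler_norml => /andP[? ?] /andP[? ?]; apply/andP; split; lra.
have [x0|x0|->] := ltgtP x 0; last by [].
- have [y yx||c cx pc] := @MVT _ p (fun y => f1 y - f1 0 + K * y) _ _ x0.
  + exact/dp/(sub _ _ _ xd n0 yx).
  + exact: (cont _ _ dp).
  + have cd := sub _ _ _ xd n0 cx.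
    have c0 : c < 0 by move: cx; rewrite in_itv/= => /andP[].
    have [y yc||e ec f1c] := @MVT _ f1 f2 _ _ c0.
    * exact/df1/(sub _ _ _ cd n0 yc).
    * exact: (cont _ _ df1).
    * have f2e := f2K _ (sub _ _ _ cd n0 ec).
      rewrite -subr_le0 pc (_ : f1 c - f1 0 + K * c = (f2 e + K) * c); last lra.
      by rewrite mulr_le0_ge0 ?mulr_ge0_le0//; lra.
- have [y yx||c cx pc] := @MVT _ p (fun y => f1 y - f1 0 + K * y) _ _ x0.
  + exact/dp/(sub _ _ _ n0 xd yx).
  + exact: (cont _ _ dp).
  + have cd := sub _ _ _ n0 xd cx.
    have c0 : 0 < c by move: cx; rewrite in_itv/= => /andP[].
    have [y yc||e ec f1c] := @MVT _ f1 f2 _ _ c0.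
    * exact/df1/(sub _ _ _ n0 cd yc).
    * exact: (cont _ _ df1).
    * have f2e := f2K _ (sub _ _ _ n0 cd ec).
      rewrite -subr_ge0 pc (_ : f1 c - f1 0 + K * c = (f2 e + K) * c); last lra.
      by rewrite !mulr_ge0//; lra.
Qed.

Lemma ln1D_norm (d x : R) : d <= 2^-1 -> `|x| <= d -> `|ln (1 + x)| <= 2 * d.
Proof.
move=> d2 xd; have := xd; rewrite ler_norml => /andP[x1 x2].
have x0 : 0 < 1 + x by lra.
rewrite ler_norml; apply/andP; split.
  rewrite lerNl -lnV ?posrE//.
  have := @le_ln1Dx _ ((1 + x)^-1 - 1).
  rewrite addrCA subrr addr0 => H.
  have i0 : 0 < (1 + x)^-1 by rewrite invr_gt0.
  have: ln (1 + x)^-1 <= (1 + x)^-1 - 1 by apply: H; lra.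
  move=> /le_trans; apply.
  rewrite lerBlDr -[leLHS]mul1r ler_pdivrMr//; nra.
apply: le_trans (le_ln1Dx _) _; lra.
Qed.

(* Bounds minus the second derivative of [x |-> goverlap s (l + ln (1 + x))]
   on [|x| <= d]. *)
Definition goverlap_curv s l (d : R) :=
  expR l * (gpdf (goverlap_arg s (- l)) + d * (2 + 4 / s)) / s.

(** In the ratio 1 + x the factor exp(ln(1 + x)) of the first derivative cancels against the chain
    rule factor 1 / (1 + x). The second derivative therefore consists of a single Gaussian density
    term. *)
Lemma goverlap_taylor s l (d x : R) : 0 < s -> d <= 2^-1 -> `|x| <= d ->
  goverlap s l + expR l * gcdf (goverlap_arg s (- l)) * x - goverlap_curv s l d / 2 * x ^+ 2
    <= goverlap s (l + ln (1 + x)).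
Proof.
move=> s0 d2 xd; have sn0 : s != 0 by rewrite gt_eqF.
have x10 y : `|y| <= d -> 0 < 1 + y.
  by rewrite ler_norml => /andP[]; lra.
pose f y := goverlap s (l + ln (1 + y)).
pose f1 y := expR l * gcdf (goverlap_arg s (- (l + ln (1 + y)))).
pose f2 y := - (expR l * gpdf (goverlap_arg s (- (l + ln (1 + y)))) / (s * (1 + y))).
have dln y : `|y| <= d -> is_derive y 1 (fun y => l + ln (1 + y)) (1 + y)^-1.
  move=> /x10 y0.
  have h : is_derive y 1 (fun y : R => 1 + y) 1.
    by have := is_deriveD (is_derive_cst (1 : R) y 1) (is_derive_id y 1); rewrite add0r.
  have h1 := @is_derive1_comp _ (@ln R) (fun y => 1 + y) _ _ _ (is_derive1_ln y0) h.
  by have := is_deriveD (is_derive_cst (l : R) y 1) h1; rewrite add0r mulr1.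
have df y : `|y| <= d -> is_derive y 1 f (f1 y).
  move=> yd; have y0 := x10 _ yd.
  have := @is_derive1_comp _ (goverlap s) _ y _ _ (is_derive_goverlap _ sn0) (dln _ yd).
  by rewrite expRD lnK ?posrE// mulrAC mulfK ?gt_eqF.
have df1 y : `|y| <= d -> is_derive y 1 f1 (f2 y).
  move=> yd; have y0 := x10 _ yd; have h := dln _ yd.
  have h1 : is_derive y 1 (fun y => goverlap_arg s (- (l + ln (1 + y)))) (- (s * (1 + y))^-1).
    rewrite (_ : (fun y => goverlap_arg s _) = s^-1 *: - (fun y => l + ln (1 + y)) - cst (s / 2)).
      have := is_deriveB (is_deriveZ s^-1 (is_deriveN h)) (is_derive_cst (s / 2) y 1).
      by rewrite subr0 /GRing.scale/= mulrN invfM.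
    by apply/funext => z; rewrite /goverlap_arg [LHS]/= [_ / s]mulrC.
  have h2 := @is_derive1_comp _ gcdf _ y _ _ (is_derive_gcdf _) h1.
  have h3 := is_deriveZ (expR l) h2.
  apply: is_derive_eq.
  by rewrite /f2 /GRing.scale/= mulrN mulrN mulrA.
have := @taylor2_ge f f1 f2 (goverlap_curv s l d) d x df df1.
rewrite /f /f1 !addr0 !ln1 !addr0; apply => // y yd.
have y0 := x10 _ yd.
rewrite /f2 lerN2 /goverlap_curv invfM -!mulrA ler_pM2l ?expR_gt0// [leRHS]mulrC mulrCA.
rewrite ler_pM2l ?invr_gt0//.
rewrite ler_pdivrMr//.
have lip := gpdf_lip (goverlap_arg s (- (l + ln (1 + y)))) (goverlap_arg s (- l)).
have E : goverlap_arg s (- (l + ln (1 + y))) - goverlap_arg s (- l) = - ln (1 + y) / s.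
  by rewrite /goverlap_arg; field.
rewrite E normrM normrN normfV (gtr0_norm s0) in lip.
have lnb := ln1D_norm d2 yd.
have lip2 : `|ln (1 + y)| / s <= 2 * d / s by rewrite ler_pM2r ?invr_gt0.
have g1 := ler_norm (gpdf (goverlap_arg s (- (l + ln (1 + y)))) - gpdf (goverlap_arg s (- l))).
have p1 := gpdf_le1 (goverlap_arg s (- l)).
have p0 := gpdf_gt0 (goverlap_arg s (- l)).
move: yd; rewrite ler_norml => /andP[y1 y2].
have si : 0 < s^-1 by rewrite invr_gt0.
apply: (@le_trans _ _ (gpdf (goverlap_arg s (- l)) + 2 * d * s^-1)); first lra.
have d0 : 0 <= d by lra.
set g := gpdf _ in p1 p0 *.
(* The left side is at least g + 2 * d / s: as g <= 1 and d <= 1/2, the summand 2 * d pays for the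
   loss d * g and for its own shrinking, and 4 * d / s still leaves 2 * d / s, the Lipschitz
   error. *)
have : (1 - d) * (g + d * (2 + 4 / s)) <= (1 + y) * (g + d * (2 + 4 / s)).
  by rewrite ler_wpM2r; nra.
have ds : 0 <= d * s^-1 by rewrite mulr_ge0// ltW.
nra.
Qed.

(** The mean value theorem gives the decrease as a density at some u between s and sqrt(s^2 + t),
    times the increment of s. Uniformity in l comes from comparing densities multiplicatively: the
    exponent is - l^2 / (2 u^2) + l / 2 - u^2 / 8, and the only part decreasing in u is free of l,
    so replacing s by u costs at most the factor exp(- t / 8). *)
Lemma goverlap_shift_le (s0 s t l : R) : 0 < s0 -> s0 <= s -> 0 <= t ->
  goverlap (Num.sqrt (s ^+ 2 + t)) l <=
  goverlap s l - t / (2 * s) * gpdf (goverlap_arg s l) + t ^+ 2 * (s0 ^- 3 + s0^-1).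
Proof.
move=> s00 s0s; rewrite le_eqVlt => /predU1P[<-|t0].
  rewrite addr0 sqrtr_sqr ger0_norm; last by lra.
  by rewrite mul0r mul0r subr0 expr2 !mul0r addr0.
have sp : 0 < s by lra.
set s' := Num.sqrt _.
have s'0 : 0 <= s' by exact: sqrtr_ge0.
have s'E : s' ^+ 2 = s ^+ 2 + t by rewrite sqr_sqrtr//; nra.
have ss' : s < s' by nra.
have [u us||u us YE] := @MVT _ (fun s => goverlap s l) (fun s => - gpdf (goverlap_arg s l)) _ _ ss'.
- apply: is_derive_goverlap_shift; move: us; rewrite in_itv/= => /andP[su _].
  by rewrite gt_eqF// (lt_trans sp).
- apply: derivable_within_continuous => u; rewrite in_itv/= => /andP[su _].
  have u0 : u != 0 by rewrite gt_eqF// (lt_le_trans sp).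
  by have [] := is_derive_goverlap_shift l u0.
move: us; rewrite in_itv/= => /andP[su us'].
have gu : gpdf (goverlap_arg s l) - t / 8 <= gpdf (goverlap_arg u l).
  have : gpdf (goverlap_arg s l) * expR (- t / 8) <= gpdf (goverlap_arg u l).
    rewrite !gpdfE -mulrA -expRD ler_wpM2l ?invr_ge0//.
    rewrite ler_expR /goverlap_arg.
    have E v : v != 0 -> - (l / v - v / 2) ^+ 2 / 2 = - (l ^+ 2 / v ^+ 2) / 2 + l / 2 - v ^+ 2 / 8.
      by move=> v0; field.
    rewrite !E ?gt_eqF//; last by lra.
    have : l ^+ 2 / u ^+ 2 <= l ^+ 2 / s ^+ 2.
      rewrite ler_wpM2l ?sqr_ge0// lef_pV2 ?posrE ?exprn_gt0//; last by lra.
      by rewrite ler_pXn2r ?nnegrE//; lra.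
    nra.
  apply: le_trans.
  have e1 := expR_ge1Dx (- t / 8).
  have g1 := gpdf_le1 (goverlap_arg s l).
  have g0 := gpdf_gt0 (goverlap_arg s l).
  nra.
have si0 : 0 < s^-1 by rewrite invr_gt0.
have s0i : s^-1 <= s0^-1 by rewrite lef_pV2 ?posrE.
have ds1 : s' - s <= t * s^-1 / 2.
  have : (s' - s) * (2 * s) <= t by nra.
  by rewrite -ler_pdivlMr ?mulr_gt0// invfM; lra.
have ds2 : t * s^-1 / 2 - t ^+ 2 * s ^- 3 <= s' - s.
  have -> : s' - s = t * s^-1 / 2 - (s' - s) ^+ 2 * s^-1 / 2.
    have : t = (s' - s) * (s' + s) by nra.
    by move=> ->; field; rewrite gt_eqF.
  have : (s' - s) ^+ 2 <= (t * s^-1 / 2) ^+ 2.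
    by rewrite ler_pXn2r ?nnegrE//; nra.
  have -> : s ^- 3 = s^-1 * s^-1 ^+ 2 by rewrite -exprVn exprS.
  move: si0; set w := s^-1 => w0 h.
  have := ler_wpM2r (ltW w0) h.
  have : 0 <= t ^+ 2 * w ^+ 3 by rewrite mulr_ge0// exprn_ge0 ?ltW.
  nra.
have s3 : s ^- 3 <= s0 ^- 3.
  by rewrite -!exprVn ler_pXn2r ?nnegrE// ?invr_ge0; lra.
have g1 := gpdf_le1 (goverlap_arg s l).
have g0 := gpdf_gt0 (goverlap_arg s l).
have i3 : 0 < s ^- 3 by rewrite -exprVn exprn_gt0.
rewrite invfM.
move: YE => /= YE.
have : goverlap s' l = goverlap s l - gpdf (goverlap_arg u l) * (s' - s) by lra.
move=> ->.
set g := gpdf (goverlap_arg s l) in gu g1 g0 *; set w := s^-1 in si0 s0i ds1 ds2 *.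
set h := gpdf (goverlap_arg u l) in gu *.
have h0 : 0 < h by exact: gpdf_gt0.
have D : 0 < s' - s by rewrite subr_gt0.
have h1 : (g - t / 8) * (s' - s) <= h * (s' - s) by rewrite ler_wpM2r// ltW.
have h2 : t * (s' - s) <= t * (t * w / 2) by rewrite ler_wpM2l// ltW.
have h3 : g * (t * w / 2 - t ^+ 2 * s ^- 3) <= g * (s' - s) by rewrite ler_wpM2l// ltW.
have h4 : g * (t ^+ 2 * s ^- 3) <= t ^+ 2 * s0 ^- 3.
  apply: (@le_trans _ _ (t ^+ 2 * s ^- 3)).
    by rewrite ler_piMl// mulr_ge0 ?sqr_ge0// ltW.
  by rewrite ler_wpM2l ?sqr_ge0.
have h5 : t ^+ 2 * w <= t ^+ 2 * s0^-1 by rewrite ler_wpM2l ?sqr_ge0.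
have h6 : 0 <= t ^+ 2 * w by rewrite mulr_ge0 ?sqr_ge0// ltW.
nra.
Qed.

Lemma goverlapN s l : s != 0 -> goverlap s l = expR l * goverlap s (- l).
Proof.
move=> s0; rewrite /goverlap opprK mulrDr mulrA -expRD subrr expR0 mul1r.
by rewrite addrC.
Qed.

Lemma goverlap_ge0 s l : 0 <= goverlap s l.
Proof. by rewrite addr_ge0 ?mulr_ge0 ?gcdf_ge0 ?expR_ge0. Qed.

(** The difference [expR - goverlap s] has a nonnegative derivative, and both terms vanish at -oo.
    Working with the closed form dispenses with the integral representation. *)
Lemma goverlap_le_expR s l : 0 < s -> goverlap s l <= expR l.
Proof.
move=> s0; have sn0 : s != 0 by rewrite gt_eqF.
have mono m : m < l -> goverlap s l - expR l <= goverlap s m.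
  move=> ml.
  have [u us||u us /= YE] := @MVT _ (expR - goverlap s)
    (fun l => expR l - expR l * gcdf (goverlap_arg s (- l))) _ _ ml.
  - by have h := is_derive_goverlap u sn0; exact: is_deriveB.
  - apply: derivable_within_continuous => u _.
    by have h := is_derive_goverlap u sn0; apply: derivableB.
  have e0 := expR_gt0 m; have e1 := expR_gt0 u.
  have g1 := gcdf_le1 (goverlap_arg s (- u)).
  move: YE; rewrite !fctE/= => YE.
  have : 0 <= (expR u - expR u * gcdf (goverlap_arg s (- u))) * (l - m).
    by rewrite mulr_ge0//; nra.
  lra.
apply/ler_addgt0Pr => e e0.
have e20 : 0 < e / 2 by lra.
have /cvgrPdist_lt/(_ _ e20)[A [rA HA]] := @cvg_gcdfNy R.
(* The three terms put m below l, make the first summand of [goverlap s m] less than e / 2, and make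
   the second, which is at most [expR m], no more than e / 2. *)
pose m := Num.min (Num.min (l - 1) (s * (A - 1))) (ln (e / 2)).
have ml : m <= l - 1 by rewrite /m !ge_min lexx.
have mA : m <= s * (A - 1) by rewrite /m !ge_min lexx orbT.
have me : m <= ln (e / 2) by rewrite /m !ge_min lexx !orbT.
have := mono m; have -> : m < l by lra.
move=> /(_ isT).
have mA' : goverlap_arg s m < A.
  have : m / s <= A - 1 by rewrite ler_pdivrMr// mulrC.
  rewrite /goverlap_arg; lra.
have := HA _ mA'; rewrite sub0r normrN ger0_norm ?gcdf_ge0//.
rewrite [goverlap s m]/goverlap.
have : expR m * gcdf (goverlap_arg s (- m)) <= expR m.
  by rewrite ler_piMr ?expR_ge0 ?gcdf_le1.
have : expR m <= e / 2 by rewrite -[leRHS]lnK ?posrE// ler_expR.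
lra.
Qed.

Lemma goverlap_le1 s l : 0 < s -> goverlap s l <= 1.
Proof.
move=> s0; rewrite goverlapN ?gt_eqF// -[leRHS]expR0 -(subrr l) expRD.
by rewrite ler_pM2l ?expR_gt0// goverlap_le_expR.
Qed.

Lemma goverlap0 s : goverlap s 0 = 2 * (1 - gcdf (s / 2)).
Proof. by rewrite /goverlap /goverlap_arg oppr0 mul0r sub0r expR0 mul1r gcdfN; ring. Qed.

End gaussian_overlap_bounds.

(** * The overlap as a function of two weights, and one step of the recursion *)

Section overlap.
Context {R : realType}.
Implicit Types s a b : R.

(** The degree-one homogeneous function with value [goverlap s l] at the weights 1 and e^l. The
    value 0 agrees with the integral of the minimum when a weight vanishes. *)
Definition overlap s a b : R :=
  if (0 < a) && (0 < b) then a * goverlap s (ln (b / a)) else 0.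

Lemma overlap_le s a b : 0 < s -> 0 <= a -> 0 <= b ->
  overlap s a b <= Num.min a b.
Proof.
move=> s0 a0 b0; rewrite /overlap; case: ifPn => [/andP[ap bp]|_]; last first.
  by rewrite le_min a0 b0.
rewrite le_min -[leRHS]mulr1 ler_pM2l// goverlap_le1//=.
rewrite -ler_pdivlMl// [leRHS]mulrC.
by rewrite -[leRHS](@lnK _ (b / a)) ?posrE ?divr_gt0// goverlap_le_expR.
Qed.

(* [1 + x] is the ratio [r' / r], so that [r * x = r' - r]. *)
Lemma overlap_quad s a b (d r r' : R) : 0 < s -> 0 < a -> 0 < b ->
  0 < d -> d <= 8^-1 -> `|r - 1| <= d -> `|r' - 1| <= d ->
  a * (goverlap s (ln (b / a)) * r
       + expR (ln (b / a)) * gcdf (goverlap_arg s (- ln (b / a))) * (r' - r)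
       - goverlap_curv s (ln (b / a)) (4 * d) / (2 * (1 - d)) * (r' - r) ^+ 2)
    <= overlap s (a * r) (b * r').
Proof.
move=> s0 a0 b0 d0 d8 rd r'd; set l := ln (b / a).
have := rd; have := r'd; rewrite !ler_norml => /andP[r'1 r'2] /andP[r1 r2].
have rp : 0 < r by lra.
have rp' : 0 < r' by lra.
pose x := r' / r - 1.
have rx : r * x = r' - r by rewrite /x; field; rewrite gt_eqF.
(* Here |r' - r| <= 2 * d and r >= 7/8. The hypothesis d <= 1/8 also makes 4 * d <= 1/2, as the
   expansion requires. *)
have xd : `|x| <= 4 * d.
  have -> : x = (r' - r) / r by rewrite /x; field; rewrite gt_eqF.
  rewrite normrM normfV (gtr0_norm rp) ler_pdivrMr//.
  by rewrite ler_norml; apply/andP; split; nra.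
have d4 : 4 * d <= 2^-1 by lra.
have T := goverlap_taylor l s0 d4 xd.
have K0 : 0 <= goverlap_curv s l (4 * d).
  rewrite /goverlap_curv divr_ge0 ?(ltW s0)// mulr_ge0 ?expR_ge0// addr_ge0 ?(ltW (gpdf_gt0 _))//.
  by rewrite mulr_ge0 ?addr_ge0 ?divr_ge0 ?(ltW s0)//; lra.
rewrite /overlap !mulr_gt0//= -[leRHS]mulrA ler_pM2l//.
have x1 : 1 + x = r' / r by rewrite /x; ring.
have -> : ln (b * r' / (a * r)) = l + ln (1 + x).
  rewrite x1 /l -lnM ?posrE ?divr_gt0//.
  by rewrite invfM mulrACA.
have := ler_wpM2l (ltW rp) T; apply: le_trans.
set g := expR l * _; set K := goverlap_curv s l (4 * d) in K0 *.
have -> : r * (goverlap s l + g * x - K / 2 * x ^+ 2)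
    = goverlap s l * r + g * (r * x) - K / 2 * ((r * x) ^+ 2 / r).
  by field; rewrite gt_eqF.
have d1 : 0 < 1 - d by lra.
have -> : K / (2 * (1 - d)) * (r' - r) ^+ 2 = K / 2 * ((r' - r) ^+ 2 / (1 - d)).
  by field; rewrite gt_eqF.
rewrite rx; apply: lerB => //.
apply: ler_wpM2l; first by rewrite divr_ge0.
apply: ler_wpM2l; first exact: sqr_ge0.
by rewrite lef_pV2 ?posrE//; lra.
Qed.

(** Three sources: errors [al] in the mass and in the mean increment, the excess of [goverlap_curv]
    over the curvature at 0, and the second-order remainder of enlarging the variance by t. *)
Definition step_err s0 (d t al : R) : R :=
  2 * al + t * (2 * d * (2 + 4 / s0) / s0) + t ^+ 2 * (s0 ^- 3 + s0^-1).

(** M1, M2, M3 stand for the truncated averages of r, r' - r and (r' - r)^2. The factor 1 - d in the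
    bound on M3 cancels that of the quadratic term, whose loss has main part t / (2 s) times
    [gpdf (goverlap_arg s l)]: this is the decrease of [goverlap] when s^2 grows by t. After
    division by a the errors are multiples of 1 and e^l, hence of a and b. *)
Lemma overlap_step s0 s a b (d t al M1 M2 M3 : R) : 0 < s0 -> s0 <= s ->
  0 < a -> 0 < b -> 0 < d -> d <= 8^-1 -> 0 <= t -> 0 <= al ->
  1 - al <= M1 -> `|M2| <= al -> 0 <= M3 -> M3 <= (1 - d) * t ->
  overlap (Num.sqrt (s ^+ 2 + t)) a b - step_err s0 d t al * (a + b) <=
  a * (goverlap s (ln (b / a)) * M1
       + expR (ln (b / a)) * gcdf (goverlap_arg s (- ln (b / a))) * M2
       - goverlap_curv s (ln (b / a)) (4 * d) / (2 * (1 - d)) * M3).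
Proof.
move=> s00 s0s a0 b0 d0 d8 t0 al0 hM1 hM2 M30 hM3; set l := ln (b / a).
have sp : 0 < s by lra.
have sn0 : s != 0 by rewrite gt_eqF.
have bE : b = a * expR l by rewrite /l lnK ?posrE ?divr_gt0// mulrC divfK ?gt_eqF.
rewrite /overlap a0 b0/= -/l [in X in _ - _ * X]bE.
have -> : a + a * expR l = a * (1 + expR l) by ring.
rewrite mulrCA -mulrBr ler_pM2l//.
have e0 := expR_gt0 l; set e := expR l in e0 *.
have Yt := goverlap_shift_le l s00 s0s t0.
have Y0 := goverlap_ge0 s l; have Y1 := goverlap_le1 l sp.
have h1 : goverlap s l - al <= goverlap s l * M1 by nra.
have h2 : - (e * al) <= e * gcdf (goverlap_arg s (- l)) * M2.
  rewrite -mulrA -mulrN ler_pM2l//.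
  have g0 := gcdf_ge0 (goverlap_arg s (- l)); have g1 := gcdf_le1 (goverlap_arg s (- l)).
  rewrite lerNl -mulrN; move: hM2; rewrite ler_norml => /andP[h _]; nra.
have K0 : 0 <= goverlap_curv s l (4 * d).
  rewrite /goverlap_curv divr_ge0 ?(ltW sp)// mulr_ge0 ?expR_ge0// addr_ge0 ?(ltW (gpdf_gt0 _))//.
  by rewrite mulr_ge0 ?addr_ge0 ?divr_ge0 ?(ltW sp)//; lra.
have h3 : goverlap_curv s l (4 * d) / (2 * (1 - d)) * M3 <= goverlap_curv s l (4 * d) * (t / 2).
  rewrite -mulrA ler_wpM2l// ler_pdivrMl; lra.
have KE : goverlap_curv s l (4 * d) * (t / 2) =
    t / (2 * s) * gpdf (goverlap_arg s l) + e * (t * (2 * d * (2 + 4 / s) / s)).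
  by rewrite -(gpdf_goverlap_argN l sn0) /goverlap_curv -/e; field.
have si : s^-1 <= s0^-1 by rewrite lef_pV2 ?posrE.
have si0 : 0 < s^-1 by rewrite invr_gt0.
have h4 : t * (2 * d * (2 + 4 / s) / s) <= t * (2 * d * (2 + 4 / s0) / s0).
  apply: ler_wpM2l => //; rewrite -!(mulrA (2 * d)).
  apply: ler_wpM2l; first by rewrite mulr_ge0// ltW.
  by apply: ler_pM => //; move: si si0; clear; lra.
have h50 : 0 <= t * (2 * d * (2 + 4 / s0) / s0).
  have i0 : 0 < s0^-1 by rewrite invr_gt0.
  by rewrite !mulr_ge0//; move: i0 d0; clear; lra.
have h6 : 0 <= t ^+ 2 * (s0 ^- 3 + s0^-1).
  by rewrite mulr_ge0 ?sqr_ge0// addr_ge0 ?invr_ge0 ?exprn_ge0// ltW.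
have h5 := ler_wpM2l (ltW e0) h4.
rewrite /step_err.
set A := t * (2 * d * (2 + 4 / s0) / s0) in h5 h50 *.
set B := t ^+ 2 * _ in Yt h6 *.
have eB : 0 <= e * B by rewrite mulr_ge0// ltW.
have ea : 0 <= e * al by rewrite mulr_ge0// ltW.
lra.
Qed.

End overlap.

(** * The recursion over the sample size *)

Section iid_integral.
Context (d : measure_display) (X : measurableType d) (R : realType).
Local Open Scope ereal_scope.

Lemma measurable_tcons_slice (P : probability X R) n (f : n.+1.-tuple X -> \bar R) :
  measurable_fun setT f -> (forall x, 0 <= f x) ->
  measurable_fun setT (fun x => \int[iid P n]_t f (tcons (x, t))).
Proof.
move=> mf f0.
apply: (@measurable_fun_fubini_tonelli_F _ _ _ _ _ (iid P n) (f \o @tcons _ _ n)) => //.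
  exact: measurableT_comp.
by move=> u; exact: f0.
Qed.

Lemma integral_iidS (P : probability X R) n (f : n.+1.-tuple X -> \bar R) :
  measurable_fun setT f -> (forall x, 0 <= f x) ->
  \int[iid P n.+1]_x f x = \int[P]_x \int[iid P n]_t f (tcons (x, t)).
Proof.
move=> mf f0 /=.
rewrite ge0_integral_distribution//.
by rewrite fubini_tonelli1//=; exact: measurableT_comp.
Qed.

End iid_integral.

Section integrableR.
Context d (T : measurableType d) (R : realType) (mu : {measure set T -> \bar R}).
Variables (D : set T) (f g : T -> R).

Lemma integrableRZl k : measurable D -> mu.-integrable D (EFin \o f) ->
  mu.-integrable D (EFin \o (fun x => k * f x)).
Proof.
move=> mD /(integrableZl mD k); apply: eq_integrable => // x _.
Qed.

Lemma integrableRD : measurable D -> mu.-integrable D (EFin \o f) ->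
  mu.-integrable D (EFin \o g) -> mu.-integrable D (EFin \o (fun x => f x + g x)).
Proof. by move=> mD hf hg; exact: (integrableD mD hf hg). Qed.

Lemma integrableRB : measurable D -> mu.-integrable D (EFin \o f) ->
  mu.-integrable D (EFin \o g) -> mu.-integrable D (EFin \o (fun x => f x - g x)).
Proof. by move=> mD hf hg; exact: (integrableB mD hf hg). Qed.

End integrableR.

Section near1.
Context d (T : measurableType d) (R : realType).

Definition near1 (dl : R) (r r' : T -> R) : set T :=
  [set x | `|r x - 1| <= dl /\ `|r' x - 1| <= dl].

Lemma measurable_near1 dl r r' : measurable_fun setT r -> measurable_fun setT r' ->
  measurable (near1 dl r r').
Proof.
move=> mr mr'.
have mabs (f : T -> R) : measurable_fun setT f -> measurable [set x | `|f x - 1| <= dl].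
  move=> mf; have : measurable_fun setT (fun x => `|f x - 1|).
    by apply: measurableT_comp => //; exact: measurable_funB.
  move=> /(_ measurableT _ (measurable_itv `]-oo, dl])); rewrite setTI.
  by congr measurable; apply/seteqP; split=> x; rewrite /= in_itv.
exact: measurableI (mabs _ mr) (mabs _ mr').
Qed.

End near1.

Section two_point_recursion.
Context (d : measure_display) (X : measurableType d) (R : realType).
Variables (P0 P Q : probability X R) (r r' : X -> R).
Hypotheses (mr : measurable_fun setT r) (mr' : measurable_fun setT r').
Hypotheses (r0 : forall x, 0 <= r x) (r'0 : forall x, 0 <= r' x).
Hypothesis domP : forall f : X -> \bar R, measurable_fun setT f ->
  (forall x, 0 <= f x)%E -> (\int[P0]_x ((r x)%:E * f x) <= \int[P]_x f x)%E.
Hypothesis domQ : forall f : X -> \bar R, measurable_fun setT f ->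
  (forall x, 0 <= f x)%E -> (\int[P0]_x ((r' x)%:E * f x) <= \int[Q]_x f x)%E.

Definition weighted_risk n (a b : R) (phi : n.-tuple X -> R) : \bar R :=
  (a%:E * \int[iid P n]_x (phi x)%:E + b%:E * \int[iid Q n]_x (1 - phi x)%:E)%E.

Variables (s0 dl t al : R).
Hypotheses (s00 : 0 < s0) (dl0 : 0 < dl) (dl8 : dl <= 8^-1) (t0 : 0 <= t) (al0 : 0 <= al).
Let G := near1 dl r r'.
Hypotheses (hM1 : 1 - al <= \int[P0]_(x in G) r x)
  (hM2 : `|\int[P0]_(x in G) (r' x - r x)| <= al)
  (hM3 : \int[P0]_(x in G) ((r' x - r x) ^+ 2) <= (1 - dl) * t).

Let c := step_err s0 dl t al.

Let mG : measurable G := measurable_near1 dl mr mr'.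

Let c0 : 0 <= c.
Proof.
move: s00 dl0 t0 al0 => s0p dlp tp alp.
have i0 : 0 < s0^-1 by rewrite invr_gt0.
have h1 : 0 <= t * (2 * dl * (2 + 4 / s0) / s0) by rewrite !mulr_ge0//; lra.
have h2 : 0 <= t ^+ 2 * (s0 ^- 3 + s0^-1).
  by rewrite mulr_ge0 ?sqr_ge0// addr_ge0 ?invr_ge0 ?exprn_ge0// ltW.
by rewrite /c /step_err; lra.
Qed.

Let bounded_G (f : X -> R) (C : R) : measurable_fun setT f ->
  (forall x, G x -> `|f x| <= C) -> P0.-integrable G (EFin \o f).
Proof.
move=> mf fC; apply: measurable_bounded_integrable => //.
- by rewrite (le_lt_trans (probability_le1 _ _))// ltry.
- exact: measurable_funTS.
- exists C; split; first exact: num_real.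
  by move=> M CM x /= Gx; rewrite (le_trans (fC _ Gx))// ltW.
Qed.

Let iG1 : P0.-integrable G (EFin \o r).
Proof.
apply: (bounded_G (C := 2)) => // x [+ _]; move: dl8 => dlp; rewrite ler_norml => /andP[? ?].
rewrite ger0_norm//; lra.
Qed.

Let iG2 : P0.-integrable G (EFin \o (fun x => r' x - r x)).
Proof.
apply: (bounded_G (C := 2)); first exact: measurable_funB.
move: dl8 => dlp x []; rewrite !ler_norml => /andP[? ?] /andP[? ?].
by apply/andP; split; lra.
Qed.

Let iG3 : P0.-integrable G (EFin \o (fun x => (r' x - r x) ^+ 2)).
Proof.
apply: (bounded_G (C := 2)); first by apply: measurable_funX; exact: measurable_funB.
move: dl8 => dlp x []; rewrite !ler_norml => /andP[? ?] /andP[? ?].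
by apply/andP; split; nra.
Qed.

(** The error of the induction hypothesis, W, is added to the conditional risk Z before restricting
    to G. As Z + W is nonnegative everywhere, the complement of G can be discarded, and W integrates
    to at most n c (a + b). *)
Lemma weighted_risk_ge n a b (phi : n.-tuple X -> R) : 0 <= a -> 0 <= b ->
  is_test phi ->
  ((overlap (Num.sqrt (s0 ^+ 2 + n%:R * t)) a b - n%:R * c * (a + b))%:E
    <= weighted_risk a b phi)%E.
Proof.
move: s00 dl0 dl8 t0 al0 => s0p dlp dlp8 tp alp.
elim: n a b phi => [|n IH] a b phi a0 b0 [mphi phi01].
  rewrite /weighted_risk/= !integral_dirac//; last 2 first.
  - by apply/measurable_EFinP; exact: measurable_funB.
  - exact/measurable_EFinP.
  rewrite !diracT !mul1e -!EFinM -EFinD lee_fin mul0r addr0 sqrtr_sqr (gtr0_norm s00) !mul0r subr0.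
  apply: le_trans (overlap_le s00 a0 b0) _.
  have /andP[p0 p1] := phi01 [tuple].
  have [ab|/ltW ab] := leP a b; nra.
set sn := Num.sqrt (s0 ^+ 2 + n%:R * t).
have s0n : s0 <= sn.
  rewrite -[leLHS](gtr0_norm s00) -sqrtr_sqr ler_wsqrtr// lerDl mulr_ge0//.
have sn0 : 0 < sn by lra.
have snS : Num.sqrt (s0 ^+ 2 + n.+1%:R * t) = Num.sqrt (sn ^+ 2 + t).
  rewrite sqr_sqrtr; first by congr Num.sqrt; rewrite -natr1; ring.
  by rewrite addr_ge0 ?sqr_ge0 ?mulr_ge0.
pose A x : \bar R := (\int[iid P n]_t (phi (tcons (x, t)))%:E)%E.
pose B x : \bar R := (\int[iid Q n]_t (1 - phi (tcons (x, t)))%:E)%E.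
have mphiE : measurable_fun setT (EFin \o phi) by exact/measurable_EFinP.
have mphiE' : measurable_fun setT (fun x => (1 - phi x)%:E).
  by apply/measurable_EFinP; exact: measurable_funB.
have phiE0 x : (0 <= (EFin \o phi) x)%E by rewrite lee_fin; case/andP: (phi01 x).
have phiE0' x : (0 <= (1 - phi x)%:E)%E by rewrite lee_fin subr_ge0; case/andP: (phi01 x).
have A0 x : (0 <= A x)%E by apply: integral_ge0 => u _; exact: phiE0.
have B0 x : (0 <= B x)%E by apply: integral_ge0 => u _; exact: phiE0'.
have mA : measurable_fun setT A by exact: (measurable_tcons_slice P mphiE).
have mB : measurable_fun setT B by exact: (measurable_tcons_slice Q mphiE').
pose Z x : \bar R := (a%:E * ((r x)%:E * A x) + b%:E * ((r' x)%:E * B x))%E.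
have mrE : measurable_fun setT (EFin \o r) by exact/measurable_EFinP.
have mrE' : measurable_fun setT (EFin \o r') by exact/measurable_EFinP.
have mrA : measurable_fun setT (fun x => (r x)%:E * A x)%E by exact: emeasurable_funM.
have mrB : measurable_fun setT (fun x => (r' x)%:E * B x)%E by exact: emeasurable_funM.
have rA0 x : (0 <= (r x)%:E * A x)%E by rewrite mule_ge0 ?lee_fin.
have rB0 x : (0 <= (r' x)%:E * B x)%E by rewrite mule_ge0 ?lee_fin.
have marA : measurable_fun setT (fun x => a%:E * ((r x)%:E * A x))%E by exact: measurable_funeM.
have mbrB : measurable_fun setT (fun x => b%:E * ((r' x)%:E * B x))%E by exact: measurable_funeM.
have Z0 x : (0 <= Z x)%E by rewrite adde_ge0// mule_ge0 ?lee_fin.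
have mZ : measurable_fun setT Z by exact: emeasurable_funD.
have riskZ : (\int[P0]_x Z x <= weighted_risk a b phi)%E.
  rewrite /weighted_risk !integral_iidS//; [|exact: phiE0..].
  rewrite ge0_integralD//; [|by move=> x _; rewrite mule_ge0 ?lee_fin..].
  by rewrite !ge0_integralZl// ?lee_fin// leeD// lee_wpmul2l ?lee_fin// ?domP ?domQ.
apply: le_trans riskZ.
have [/andP[ap bp]|ab] := boolP ((0 < a) && (0 < b)); last first.
  apply: le_trans (integral_ge0 _ _) => //; rewrite lee_fin /overlap (negbTE ab) sub0r oppr_le0.
  by rewrite !mulr_ge0// addr_ge0.
pose e := n%:R * c.
have e0 : 0 <= e by rewrite mulr_ge0.
pose W x := e * (a * r x + b * r' x).
have W0 x : 0 <= W x by rewrite mulr_ge0// addr_ge0// mulr_ge0.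
have mW : measurable_fun setT (EFin \o W).
  apply/measurable_EFinP; apply: measurable_funM => //.
  by apply: measurable_funD => //; exact: measurable_funM.
have IW : (\int[P0]_x (W x)%:E <= (e * (a + b))%:E)%E.
  have -> : (\int[P0]_x (W x)%:E = e%:E *
    (a%:E * \int[P0]_x (r x)%:E + b%:E * \int[P0]_x (r' x)%:E))%E.
    rewrite -!ge0_integralZl ?lee_fin//; [|by move=> x _; rewrite lee_fin..].
    rewrite -ge0_integralD//; last 4 first.
    - by move=> x _; rewrite mule_ge0 ?lee_fin.
    - exact: measurable_funeM.
    - by move=> x _; rewrite mule_ge0 ?lee_fin.
    - exact: measurable_funeM.
    rewrite -ge0_integralZl ?lee_fin//.
    - by apply: emeasurable_funD; exact: measurable_funeM.
    - by move=> x _; rewrite adde_ge0// mule_ge0 ?lee_fin.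
  rewrite (EFinM e) (EFinD a) lee_wpmul2l ?lee_fin// leeD//.
    rewrite -[leRHS]mule1 lee_wpmul2l ?lee_fin//.
    have := @domP (cst 1%E) (measurable_cst _) (fun=> lee01).
    have -> : (\int[P]_x cst 1 x = 1)%E by rewrite integral_cst// mul1e; exact: probability_setT.
    by under eq_integral do rewrite mule1.
  rewrite -[leRHS]mule1 lee_wpmul2l ?lee_fin//.
  have := @domQ (cst 1%E) (measurable_cst _) (fun=> lee01).
  have -> : (\int[Q]_x cst 1 x = 1)%E by rewrite integral_cst// mul1e; exact: probability_setT.
  by under eq_integral do rewrite mule1.
set l := ln (b / a).
pose q x := a * (goverlap sn l * r x + expR l * gcdf (goverlap_arg sn (- l)) * (r' x - r x)
       - goverlap_curv sn l (4 * dl) / (2 * (1 - dl)) * (r' x - r x) ^+ 2).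
have qZ x : G x -> ((q x)%:E <= Z x + (W x)%:E)%E.
  move=> [Gx Gx'].
  have h1 := overlap_quad sn0 ap bp dl0 dl8 Gx Gx'.
  have tst : is_test (fun u => phi (tcons (x, u))).
    split; last by move=> u; exact: phi01.
    have mpt : measurable_fun setT (phi \o @tcons _ X n) by exact: measurableT_comp.
    exact: (measurable_fun_pair2 x mpt).
  have := IH (a * r x) (b * r' x) _ (mulr_ge0 a0 (r0 x)) (mulr_ge0 b0 (r'0 x)) tst.
  rewrite /weighted_risk -/(A x) -/(B x) !EFinM -!muleA -/(Z x) => h2.
  rewrite -leeBlDr// -EFinB; apply: le_trans h2.
  by rewrite lee_fin; apply: lerB; [exact: h1 | rewrite -mulrA].
pose c2 := expR l * gcdf (goverlap_arg sn (- l)).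
pose c3 := goverlap_curv sn l (4 * dl) / (2 * (1 - dl)).
have i1 := integrableRZl (goverlap sn l) mG iG1.
have i2 := integrableRZl c2 mG iG2.
have i3 := integrableRZl c3 mG iG3.
have i12 := integrableRD mG i1 i2.
have i123 := integrableRB mG i12 i3.
have iq : P0.-integrable G (EFin \o q) := integrableRZl a mG i123.
have Iq : (\int[P0]_(x in G) (q x)%:E = (\int[P0]_(x in G) q x)%:E)%E.
  by rewrite fineK// integrable_fin_num.
have qE : \int[P0]_(x in G) q x = a * (goverlap sn l * \int[P0]_(x in G) r x
    + expR l * gcdf (goverlap_arg sn (- l)) * \int[P0]_(x in G) (r' x - r x)
    - goverlap_curv sn l (4 * dl) / (2 * (1 - dl)) * \int[P0]_(x in G) ((r' x - r x) ^+ 2)).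
  rewrite (RintegralZl a mG i123) (RintegralB mG i12 i3) (RintegralD mG i1 i2).
  by rewrite (RintegralZl _ mG iG1) (RintegralZl c2 mG iG2) (RintegralZl c3 mG iG3).
have M30 : 0 <= \int[P0]_(x in G) ((r' x - r x) ^+ 2).
  by apply: Rintegral_ge0 => x _; exact: sqr_ge0.
have step := overlap_step s00 s0n ap bp dl0 dl8 t0 al0 hM1 hM2 M30 hM3.
rewrite -/l -qE -/c -snS in step.
have : (\int[P0]_(x in G) (q x)%:E <= \int[P0]_x Z x + \int[P0]_x (W x)%:E)%E.
  rewrite -ge0_integralD//; last by move=> x _; rewrite lee_fin.
  have mZW : measurable_fun setT (fun x => Z x + (W x)%:E)%E by exact: emeasurable_funD.
  have ZW0 x : (0 <= Z x + (W x)%:E)%E by rewrite adde_ge0// lee_fin.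
  apply: (@le_trans _ _ (\int[P0]_(x in G) (Z x + (W x)%:E))%E); last first.
    exact: ge0_subset_integral.
  (* The lower bound q may be negative on G, while Z + W is nonnegative, so the positive part of q
     still lies below Z + W. *)
  apply: (@le_trans _ _ (\int[P0]_(x in G) (EFin \o q)^\+ x)%E).
    apply: le_integral => //; first exact: integrable_funepos.
    by move=> x _; rewrite funeposE le_max lexx.
  apply: ge0_le_integral => //.
  - by case/integrableP: (integrable_funepos mG iq).
  - exact: measurable_funTS.
  - by move=> x Gx; rewrite funeposE ge_max qZ//= ZW0.
rewrite Iq => h.
have h2 := le_trans h (leeD2l _ IW).
have h3 : ((\int[P0]_(x in G) q x - e * (a + b))%:E <= \int[P0]_x Z x)%E.
  by rewrite EFinB leeBlDr.
apply: le_trans h3; rewrite lee_fin.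
have -> : n.+1%:R * c * (a + b) = e * (a + b) + c * (a + b) by rewrite /e -natr1; ring.
lra.
Qed.

End two_point_recursion.

(** * Local moments of the likelihood ratios *)

Section density.
Context (d : measure_display) (X : measurableType d) (R : realType).
Variables (mu : {sigma_finite_measure set X -> \bar R}) (P : probability X R).
Variable p : X -> R.
Hypothesis dp : is_density mu P p.
Local Open Scope ereal_scope.

(** Since p and the Radon-Nikodym derivative have the same integral over every measurable set, they
    agree almost everywhere. *)
Lemma density_integral (f : X -> \bar R) :
  measurable_fun setT f -> (forall x, 0 <= f x) ->
  \int[P]_x f x = \int[mu]_x ((p x)%:E * f x).
Proof.
move=> mf f0; have [mp p0 Pp] := dp.
have mpE : measurable_fun setT (EFin \o p) by exact/measurable_EFinP.
have Pmu : P `<< mu.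
  apply/null_content_dominatesP => A mA muA0.
  by rewrite Pp// null_set_integral//; exact: measurable_funTS.
rewrite -(Radon_Nikodym_SigmaFinite.change_of_variables Pmu f0 measurableT mf).
have ip : mu.-integrable setT (EFin \o p).
  apply/integrableP; split => //.
  under eq_integral do rewrite gee0_abs ?lee_fin//.
  by rewrite -Pp// (le_lt_trans (probability_le1 _ _))// ltry.
apply: ae_eq_integral => //.
- apply: emeasurable_funM => //.
  exact: measurable_int (Radon_Nikodym_SigmaFinite.f_integrable Pmu).
- exact: emeasurable_funM.
- have := @integral_ae_eq _ _ _ mu setT measurableT
    (Radon_Nikodym_SigmaFinite.f P mu) (EFin \o p) ip
    (measurable_int _ (Radon_Nikodym_SigmaFinite.f_integrable Pmu)).
  have H E : E `<=` setT -> measurable E ->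
    \int[mu]_(x in E) (EFin \o p) x = \int[mu]_(x in E) Radon_Nikodym_SigmaFinite.f P mu x.
    by move=> _ mE; rewrite -Radon_Nikodym_SigmaFinite.f_integral//; exact/esym/Pp.
  move=> /(_ H); apply: filterS => x /= h xT; rewrite -h// muleC //.
Qed.

End density.

Definition ratio_rem (T : Type) (R : realType) (l r : T -> R) (h : R) (x : T) : R :=
  Num.sqrt (r x) - 1 - 2^-1 * h * l x.

(** * Likelihood ratios and the quadratic mean remainder *)

Section likelihood_ratio.
Context (d : measure_display) (X : measurableType d) (R : realType).
Variables (mu : {sigma_finite_measure set X -> \bar R}) (P0 P1 : probability X R).
Variables (p0 p1 : X -> R) (score : X -> R) (h : R).
Hypotheses (dp0 : is_density mu P0 p0) (dp1 : is_density mu P1 p1).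
Hypothesis mscore : measurable_fun setT score.

(* Vanishes where [p0] does, since [p1 x / 0 = 0]. *)
Definition lratio x : R := p1 x / p0 x.

Lemma measurable_inv (f : X -> R) : measurable_fun setT f ->
  (forall x, 0 <= f x) -> measurable_fun setT (fun x => (f x)^-1).
Proof.
move=> mf f0.
(* At 0 both the inverse and the power take the value 0. *)
rewrite (_ : (fun x => _) = (fun x => (f x) `^ (-1))).
  exact: (measurableT_comp (measurable_powR (-1))).
by apply/funext => x; rewrite powR_inv1.
Qed.

Lemma measurable_lratio : measurable_fun setT lratio.
Proof.
have [mp0 p00 _] := dp0; have [mp1 _ _] := dp1.
by apply: measurable_funM => //; exact: measurable_inv.
Qed.

Lemma lratio_ge0 x : 0 <= lratio x.
Proof. by have [_ p00 _] := dp0; have [_ p10 _] := dp1; rewrite divr_ge0. Qed.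

Lemma lratio_dominated (f : X -> \bar R) : measurable_fun setT f ->
  (forall x, 0 <= f x)%E -> (\int[P0]_x ((lratio x)%:E * f x) <= \int[P1]_x f x)%E.
Proof.
move=> mf f0; have [mp0 p00 _] := dp0; have [mp1 p10 _] := dp1.
have mr : measurable_fun setT (EFin \o lratio).
  by apply/measurable_EFinP; exact: measurable_lratio.
have mp0E : measurable_fun setT (EFin \o p0) by exact/measurable_EFinP.
have mp1E : measurable_fun setT (EFin \o p1) by exact/measurable_EFinP.
rewrite (density_integral dp0)//; last 2 first.
- exact: emeasurable_funM.
- by move=> x; rewrite mule_ge0 ?lee_fin ?lratio_ge0.
rewrite (density_integral dp1)//; apply: ge0_le_integral => //.
- by move=> x _; rewrite !mule_ge0 ?lee_fin ?lratio_ge0.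
- by apply: emeasurable_funM => //; exact: emeasurable_funM.
- exact: emeasurable_funM.
- move=> x _; rewrite muleA -EFinM lee_wpmul2r// lee_fin /lratio.
  have [->|p0n] := eqVneq (p0 x) 0; first by rewrite mul0r.
  by rewrite mulrCA divff// mulr1.
Qed.

Local Notation lratio_rem := (ratio_rem score lratio h).

Lemma measurable_sqrt (f : X -> R) : measurable_fun setT f ->
  measurable_fun setT (fun x => Num.sqrt (f x)).
Proof.
move=> mf; apply: measurableT_comp => //.
by apply: continuous_measurable_fun; exact: sqrt_continuous.
Qed.

Lemma measurable_lratio_rem : measurable_fun setT lratio_rem.
Proof.
apply: measurable_funB; last exact: measurable_funM.
by apply: measurable_funB => //; exact/measurable_sqrt/measurable_lratio.
Qed.

(** Pointwise, the remainder under the integral is p0 times the square of [ratio_rem] where p0 > 0,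
    and is p1 where p0 = 0. Hence it integrates to the P0-remainder plus the singular mass 1 - E_0
    [lratio]; both are nonnegative, so one bound controls both. The additive form avoids subtracting
    possibly infinite integrals. *)
Lemma lratio_dqm :
  (\int[P0]_x (lratio_rem x ^+ 2)%:E + 1 = \int[P0]_x (lratio x)%:E +
   \int[mu]_x ((Num.sqrt (p1 x) - Num.sqrt (p0 x)
                     - 2^-1 * h * score x * Num.sqrt (p0 x)) ^+ 2)%:E)%E.
Proof.
have [mp0 p00 _] := dp0; have [mp1 p10 Pp1] := dp1.
have mr : measurable_fun setT (EFin \o lratio).
  by apply/measurable_EFinP; exact: measurable_lratio.
have mp0E : measurable_fun setT (EFin \o p0) by exact/measurable_EFinP.
have mp1E : measurable_fun setT (EFin \o p1) by exact/measurable_EFinP.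
have mrho : measurable_fun setT (fun x => (lratio_rem x ^+ 2)%:E).
  by apply/measurable_EFinP; apply: measurable_funX; exact: measurable_lratio_rem.
pose D x := (Num.sqrt (p1 x) - Num.sqrt (p0 x)
  - 2^-1 * h * score x * Num.sqrt (p0 x)) ^+ 2.
have mD : measurable_fun setT (EFin \o D).
  apply/measurable_EFinP; apply: measurable_funX; apply: measurable_funB.
    by apply: measurable_funB; exact: measurable_sqrt.
  apply: measurable_funM; last exact: measurable_sqrt.
  exact: measurable_funM.
have D0 x : [set: X] x -> (0 <= (D x)%:E)%E by rewrite lee_fin sqr_ge0.
have rho0 x : (0 <= (lratio_rem x ^+ 2)%:E)%E by rewrite lee_fin sqr_ge0.
have r0 x : (0 <= (lratio x)%:E)%E by rewrite lee_fin lratio_ge0.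
have prho0 x : [set: X] x -> (0 <= (p0 x)%:E * (lratio_rem x ^+ 2)%:E)%E.
  by move=> _; apply: mule_ge0 => //; rewrite lee_fin.
have pr0 x : [set: X] x -> (0 <= (p0 x)%:E * (lratio x)%:E)%E.
  by move=> _; apply: mule_ge0 => //; rewrite lee_fin.
have p1E x : [set: X] x -> (0 <= (p1 x)%:E)%E by rewrite lee_fin.
have mprho : measurable_fun setT (fun x => (p0 x)%:E * (lratio_rem x ^+ 2)%:E)%E.
  exact: emeasurable_funM.
have mpr : measurable_fun setT (fun x => (p0 x)%:E * (lratio x)%:E)%E.
  exact: emeasurable_funM.
rewrite -[X in (_ + X = _)%E](probability_setT P1) Pp1//.
rewrite (density_integral dp0 mrho rho0) (density_integral dp0 mr r0).
rewrite -(ge0_integralD _ measurableT prho0 mprho p1E mp1E).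
rewrite -(ge0_integralD _ measurableT pr0 mpr D0 mD).
apply: eq_integral => x _; rewrite -!EFinM -!EFinD; congr EFin.
rewrite /D /ratio_rem /lratio.
have [p0x|p0n] := eqVneq (p0 x) 0.
  by rewrite p0x sqrtr0 !mul0r add0r mulr0 subr0 subr0 sqr_sqrtr// add0r.
have -> : p0 x * (p1 x / p0 x) = p1 x by field.
rewrite addrC; congr (_ + _).
rewrite -{1}(sqr_sqrtr (p00 x)) -exprMn; congr (_ ^+ 2).
rewrite sqrtrM// sqrtrV//.
have : Num.sqrt (p0 x) != 0 by rewrite sqrtr_eq0 -ltNge lt_neqAle eq_sym p0n p00.
by move=> ?; field.
Qed.

End likelihood_ratio.

(** * Pointwise inequalities away from 1 and near 1 *)

Section pointwise.
Context {R : realType}.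
Implicit Types r l h m k q M dl : R.

(* If [r] or [r'] is not within [dl] of [1], then
   [S = (sqrt r - 1)^2 + (sqrt r' - 1)^2] satisfies [1 <= 9 S / dl^2]. This is
   used twice: to bound [r + r'] by a multiple of [S], and to replace the
   truncated part [M^2] of [l^2] by [9 M^2 S / dl^2]. *)
Definition off_bound dl M m k l2 q : R :=
  2 * (2 + 18 / dl ^+ 2) *
  (m * k + m ^+ 2 * (9 * M ^+ 2 / dl ^+ 2) * l2
   + (2 + 18 * m * M ^+ 2 / dl ^+ 2) * q).

Definition tail_sq M l : R := if M < `|l| then l ^+ 2 else 0.

Lemma tail_sq_ge0 M l : 0 <= tail_sq M l.
Proof. by rewrite /tail_sq; case: ifP => // _; exact: sqr_ge0. Qed.

Lemma tail_sq_le M l : tail_sq M l <= l ^+ 2.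
Proof. by rewrite /tail_sq; case: ifP => // _; exact: sqr_ge0. Qed.

Lemma sqr_le_tail M l : 0 <= M -> l ^+ 2 <= tail_sq M l + M ^+ 2.
Proof.
move=> M0; rewrite /tail_sq; case: ltP => lM; first by rewrite lerDl sqr_ge0.
by rewrite add0r -(@real_normK _ l) ?num_real// ler_pXn2r ?nnegrE.
Qed.

(** With m of order 1/n, the bound S <= m l^2 + 2 q alone would integrate to O(1/n). Splitting l^2
    at level M and multiplying the bounded part by 9 S / dl^2 >= 1 leaves m times the tail, a term
    in m^2, and q, whose sum can be made o(1/n). *)
Lemma off_bound_ge dl M m r r' l h h' : 0 < dl -> dl <= 1 -> 0 <= M ->
  h ^+ 2 <= m -> h' ^+ 2 <= m -> 0 <= r -> 0 <= r' ->
  ~ (`|r - 1| <= dl /\ `|r' - 1| <= dl) ->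
  r + r' <= off_bound dl M m (tail_sq M l) (l ^+ 2)
    ((Num.sqrt r - 1 - 2^-1 * h * l) ^+ 2 + (Num.sqrt r' - 1 - 2^-1 * h' * l) ^+ 2).
Proof.
move=> d0 d1 M0 hm hm' r0 r'0 off.
set q := _ ^+ 2 + _ ^+ 2.
pose s := Num.sqrt r - 1; pose s' := Num.sqrt r' - 1; pose S := s ^+ 2 + s' ^+ 2.
have rE : r = (1 + s) ^+ 2 by rewrite /s addrC subrK sqr_sqrtr.
have rE' : r' = (1 + s') ^+ 2 by rewrite /s' addrC subrK sqr_sqrtr.
have s2 : 0 <= s ^+ 2 by exact: sqr_ge0.
have s2' : 0 <= s' ^+ 2 by exact: sqr_ge0.
have small u : u ^+ 2 <= (dl / 3) ^+ 2 -> `|(1 + u) ^+ 2 - 1| <= dl.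
  move=> u2; have ud : `|u| <= dl / 3.
    by rewrite -(ler_pXn2r (ltn0Sn 1)) ?nnegrE// ?real_normK ?num_real//; lra.
  by move: ud; rewrite !ler_norml => /andP[? ?]; apply/andP; split; nra.
(* If both |s| and |s'| were at most dl / 3, then |2 s + s^2| <= 2 dl / 3 + dl^2 / 9 <= dl, and
   likewise for s', contradicting [off]. This is the origin of the 9. *)
have Sd : (dl / 3) ^+ 2 <= S.
  rewrite leNgt; apply/negP => Sd; apply: off; rewrite {1}rE rE'.
  by split; apply: small; rewrite /S in Sd; lra.
pose w := 9 / dl ^+ 2.
have d20 : 0 < dl ^+ 2 by rewrite exprn_gt0.
have w0 : 0 < w by rewrite divr_gt0.
have wS : 1 <= w * S.
  rewrite /w mulrAC ler_pdivlMr// mul1r.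
  have -> : dl ^+ 2 = 9 * (dl / 3) ^+ 2 by field.
  by rewrite ler_pM2l.
have l20 := sqr_ge0 l.
have Sl : S <= m * l ^+ 2 + 2 * q.
  have sb u v g : (u ^+ 2 <= m -> v = (g - 2^-1 * u * l) ^+ 2 ->
      g ^+ 2 <= m * l ^+ 2 / 2 + 2 * v)%R.
    move=> um ->.
    have := ler_wpM2r l20 um.
    by have := sqr_ge0 (g - u * l); nra.
  have := sb _ _ s hm erefl; have := sb _ _ s' hm' erefl.
  rewrite /S /q -/s -/s'; lra.
have q0 : 0 <= q by rewrite addr_ge0// sqr_ge0.
have m0 : 0 <= m by rewrite (le_trans _ hm)// sqr_ge0.
have lt : l ^+ 2 <= tail_sq M l + M ^+ 2 * (w * S).
  apply: le_trans (sqr_le_tail l M0) _; rewrite lerD2l ler_peMr ?sqr_ge0//.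
have M2 := sqr_ge0 M.
have rr : r + r' <= 2 * (2 + 2 * w) * S.
  rewrite rE rE'; have := sqr_ge0 (1 - s); have := sqr_ge0 (1 - s').
  have : 4 <= 4 * (w * S) by rewrite ler_peMr.
  rewrite /S; nra.
apply: le_trans rr _.
have -> : off_bound dl M m (tail_sq M l) (l ^+ 2) q =
  2 * (2 + 2 * w) * (m * tail_sq M l + (m * M ^+ 2 * w) * (m * l ^+ 2 + 2 * q) + 2 * q).
  by rewrite /off_bound /w; field; rewrite gt_eqF.
apply: ler_wpM2l; first by rewrite mulr_ge0// addr_ge0// mulr_ge0// ltW.
apply: (le_trans (Sl)); rewrite lerD2r.
have h1 := ler_wpM2l m0 lt.
apply: le_trans h1 _; rewrite mulrDr lerD2l.
have -> : m * (M ^+ 2 * (w * S)) = m * M ^+ 2 * w * S by ring.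
apply: ler_wpM2l; last exact: Sl.
by rewrite mulr_ge0 ?(ltW w0)// mulr_ge0.
Qed.

(** Factor r' - r through square roots: their sum has square at most 4 (1 + dl), their difference is
    (h' - h) l / 2 plus remainders. The cross term is split by Young's inequality with weight dl, so
    that the coefficient of (h' - h)^2 l^2 tends to 1 with dl; the sharp constant of the local
    regime depends on this. *)
Lemma on_bound_ge dl r r' l h h' : 0 < dl -> 0 <= r -> 0 <= r' ->
  `|r - 1| <= dl -> `|r' - 1| <= dl ->
  (r' - r) ^+ 2 <= (1 + dl) ^+ 2 * (h' - h) ^+ 2 * l ^+ 2 + 8 * (1 + dl) * (1 + dl^-1) *
    ((Num.sqrt r - 1 - 2^-1 * h * l) ^+ 2 + (Num.sqrt r' - 1 - 2^-1 * h' * l) ^+ 2).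
Proof.
move=> d0 r0 r'0 /ler_normlP[_ rd] /ler_normlP[_ rd'].
set p := Num.sqrt r - 1 - _; set p' := Num.sqrt r' - 1 - _.
pose u := Num.sqrt r; pose u' := Num.sqrt r'.
have rE : r = u ^+ 2 by rewrite sqr_sqrtr.
have rE' : r' = u' ^+ 2 by rewrite sqr_sqrtr.
have ud : u' - u = 2^-1 * (h' - h) * l + (p' - p) by rewrite /p /p' -/u -/u'; ring.
set A := 2^-1 * (h' - h) * l in ud.
have step1 : (r' - r) ^+ 2 <= 4 * (1 + dl) * (u' - u) ^+ 2.
  have -> : (r' - r) ^+ 2 = (u' + u) ^+ 2 * (u' - u) ^+ 2 by rewrite rE rE'; ring.
  rewrite ler_wpM2r ?sqr_ge0//.
  have := sqr_ge0 (u' - u); nra.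
apply: le_trans step1 _.
have i0 : 0 < dl^-1 by rewrite invr_gt0.
have dd : dl * dl^-1 = 1 by rewrite divff// gt_eqF.
have step2 : (A + (p' - p)) ^+ 2 <= (1 + dl) * A ^+ 2 + (1 + dl^-1) * (p' - p) ^+ 2.
  rewrite -subr_ge0 (_ : _ - _ = dl^-1 * (dl * A - (p' - p)) ^+ 2).
    by rewrite mulr_ge0 ?sqr_ge0// ltW.
  by field; rewrite gt_eqF.
have step3 : (p' - p) ^+ 2 <= 2 * (p ^+ 2 + p' ^+ 2).
  by have := sqr_ge0 (p' + p); nra.
have step4 : (1 + dl^-1) * (p' - p) ^+ 2 <= (1 + dl^-1) * (2 * (p ^+ 2 + p' ^+ 2)).
  by apply: ler_wpM2l => //; lra.
have AE : A ^+ 2 = (h' - h) ^+ 2 * l ^+ 2 / 4 by rewrite /A; field.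
rewrite ud.
apply: (@le_trans _ _ (4 * (1 + dl) * ((1 + dl) * A ^+ 2 +
  (1 + dl^-1) * (2 * (p ^+ 2 + p' ^+ 2))))).
  by apply: ler_wpM2l; lra.
by rewrite AE le_eqVlt; apply/orP; left; apply/eqP; field; rewrite gt_eqF.
Qed.

End pointwise.

Section moments.
Context (d : measure_display) (X : measurableType d) (R : realType).
Variable (P0 : probability X R).

Lemma Rintegral_restrict_near (G : set X) (f W : X -> R) : measurable G ->
  P0.-integrable setT (EFin \o f) -> P0.-integrable setT (EFin \o W) ->
  (forall x, 0 <= W x) -> (forall x, ~ G x -> `|f x| <= W x) ->
  `|\int[P0]_x f x - \int[P0]_(x in G) f x| <= \int[P0]_x W x.
Proof.
move=> mG fi Wi W0 fW.
have fGi : P0.-integrable setT (EFin \o (f \_ G)).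
  rewrite -restrict_EFin; apply: (proj1 (integrable_mkcond _ mG)).
  exact: (integrableS measurableT mG (@subsetT _ _) fi).
rewrite [X in _ - X]Rintegral_mkcond -RintegralB//.
have ii := integrableRB measurableT fi fGi.
apply: le_trans (le_normr_Rintegral measurableT ii) _.
apply: le_Rintegral => //.
  exact: (integrable_norm ii).
move=> x _; rewrite patchE; case: ifPn => [_|/negP xG].
  by rewrite subrr normr0.
by rewrite subr0; apply: fW => Gx; apply: xG; rewrite inE.
Qed.

Lemma le_Rintegral_restrict (G : set X) (f W : X -> R) : measurable G ->
  measurable_fun setT f -> P0.-integrable setT (EFin \o W) ->
  (forall x, 0 <= W x) -> (forall x, G x -> 0 <= f x <= W x) ->
  \int[P0]_(x in G) f x <= \int[P0]_x W x.
Proof.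
move=> mG mf Wi W0 fW.
rewrite Rintegral_mkcond; apply: le_Rintegral => //.
- apply: le_integrable Wi => //.
    apply/measurable_EFinP; apply/(measurable_restrictT _ mG).
    exact: measurable_funTS.
  move=> x _ /=; rewrite lee_fin patchE; case: ifPn => [|_].
    rewrite inE => /fW/andP[f0 fle]; rewrite !ger0_norm//.
  by rewrite normr0.
- move=> x _; rewrite patchE; case: ifPn => // /set_mem/fW/andP[//].
Qed.

Variables (l : X -> R) (I0 : R).
Hypotheses (ml : measurable_fun setT l).
Hypothesis (il : P0.-integrable setT (EFin \o (fun x => l x ^+ 2))).
Hypothesis hI0 : \int[P0]_x (l x ^+ 2) = I0.

Lemma measurable_tail_sq M : measurable_fun setT (fun x => tail_sq M (l x)).
Proof.
apply: measurable_fun_if => //.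
- by apply: measurable_fun_ltr => //; exact: measurableT_comp.
- by apply: measurable_funTS; exact: measurable_funX.
Qed.

Lemma integrable_tail_sq M : P0.-integrable setT (EFin \o (fun x => tail_sq M (l x))).
Proof.
apply: le_integrable il => //.
  by apply/measurable_EFinP; exact: measurable_tail_sq.
by move=> x _ /=; rewrite lee_fin !ger0_norm ?sqr_ge0 ?tail_sq_ge0 ?tail_sq_le.
Qed.

(** D bounds the total mass missing from a ratio, and [off_bound] the mass off [near1]; its last
    argument is the sum of the two remainders. *)
Definition near1_err dl M m D : R :=
  D + off_bound dl M m (\int[P0]_x tail_sq M (l x)) I0 (2 * D).

Lemma near1_moments (r r' : X -> R) (h h' dl M m D : R) :
  measurable_fun setT r -> measurable_fun setT r' ->
  (forall x, 0 <= r x) -> (forall x, 0 <= r' x) ->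
  P0.-integrable setT (EFin \o r) -> P0.-integrable setT (EFin \o r') ->
  P0.-integrable setT (EFin \o (fun x => ratio_rem l r h x ^+ 2)) ->
  P0.-integrable setT (EFin \o (fun x => ratio_rem l r' h' x ^+ 2)) ->
  \int[P0]_x (ratio_rem l r h x ^+ 2) <= D -> \int[P0]_x (ratio_rem l r' h' x ^+ 2) <= D ->
  1 - D <= \int[P0]_x r x <= 1 -> 1 - D <= \int[P0]_x r' x <= 1 ->
  0 < dl -> dl <= 1 -> 0 <= M -> h ^+ 2 <= m -> h' ^+ 2 <= m ->
  let G := near1 dl r r' in
  [/\ 1 - near1_err dl M m D <= \int[P0]_(x in G) r x,
     `|\int[P0]_(x in G) (r' x - r x)| <= near1_err dl M m D &
     \int[P0]_(x in G) ((r' x - r x) ^+ 2) <=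
       (1 + dl) ^+ 2 * (h' - h) ^+ 2 * I0 + 16 * (1 + dl) * (1 + dl^-1) * D].
Proof.
move=> mr mr' r0 r'0 ir ir' iq iq' qD q'D /andP[r1 r2] /andP[r'1 r'2].
move=> d0 d1 M0 hm hm' G.
have mG : measurable G by exact: measurable_near1.
have m0 : 0 <= m by rewrite (le_trans _ hm)// sqr_ge0.
have i0 : 0 < dl^-1 by rewrite invr_gt0.
have iqq := integrableRD measurableT iq iq'.
pose q x := ratio_rem l r h x ^+ 2 + ratio_rem l r' h' x ^+ 2.
have q0 x : 0 <= q x by rewrite addr_ge0// sqr_ge0.
have IqD : \int[P0]_x q x <= 2 * D by rewrite RintegralD//; lra.
have il' := hI0.
pose W x := off_bound dl M m (tail_sq M (l x)) (l x ^+ 2) (q x).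
pose c1 := 2 * (2 + 18 / dl ^+ 2); pose c2 := m ^+ 2 * (9 * M ^+ 2 / dl ^+ 2).
pose c3 := 2 + 18 * m * M ^+ 2 / dl ^+ 2.
have d20 : 0 < (dl ^+ 2)^-1 by rewrite invr_gt0 exprn_gt0.
have c10 : 0 <= c1 by rewrite mulr_ge0// addr_ge0// mulr_ge0// ltW.
have c20 : 0 <= c2 by rewrite mulr_ge0 ?sqr_ge0// mulr_ge0 ?(ltW d20)// mulr_ge0// sqr_ge0.
have c30 : 0 <= c3.
  by rewrite addr_ge0// mulr_ge0 ?(ltW d20)// mulr_ge0 ?sqr_ge0// mulr_ge0.
have it := integrable_tail_sq M.
have it1 := integrableRZl m measurableT it.
have it2 := integrableRZl c2 measurableT il.
have it3 := integrableRZl c3 measurableT iqq.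
have it12 := integrableRD measurableT it1 it2.
have it123 := integrableRD measurableT it12 it3.
have iW : P0.-integrable setT (EFin \o W) := integrableRZl c1 measurableT it123.
have W0 x : 0 <= W x.
  by rewrite mulr_ge0// !addr_ge0// mulr_ge0// ?tail_sq_ge0 ?sqr_ge0.
have IW : D + \int[P0]_x W x <= near1_err dl M m D.
  rewrite /near1_err lerD2l.
  (* [off_bound] is linear in its last three arguments. *)
  have -> : \int[P0]_x W x = off_bound dl M m (\int[P0]_x tail_sq M (l x)) I0 (\int[P0]_x q x).
    rewrite (RintegralZl c1 measurableT it123) (RintegralD measurableT it12 it3).
    rewrite (RintegralD measurableT it1 it2) (RintegralZl _ measurableT it).
    by rewrite (RintegralZl c2 measurableT il) (RintegralZl c3 measurableT iqq) hI0.
  by apply: ler_wpM2l => //; rewrite lerD2l; exact: ler_wpM2l.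
have offW x : ~ G x -> r x + r' x <= W x.
  by move=> nG; exact: (off_bound_ge (l x) d0 d1 M0 hm hm' (r0 x) (r'0 x) nG).
have n1 : `|\int[P0]_x r x - \int[P0]_(x in G) r x| <= \int[P0]_x W x.
  apply: Rintegral_restrict_near => // x /offW; rewrite ger0_norm//.
  by have := r'0 x; lra.
have n2 : `|\int[P0]_x (r' x - r x) - \int[P0]_(x in G) (r' x - r x)| <= \int[P0]_x W x.
  apply: Rintegral_restrict_near => //; first exact: integrableRB.
  move=> x /offW; have := r'0 x; have := r0 x; rewrite ler_norml; clear => *.
  by apply/andP; split; lra.
split.
- by move: n1; rewrite ler_norml => /andP[_]; move: r1 IW; clear; lra.
- rewrite RintegralB// in n2.
  move: n2; rewrite !ler_norml => /andP[]; move: r1 r2 r'1 r'2 IW; clear => *.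
  by apply/andP; split; lra.
- pose a1 := (1 + dl) ^+ 2 * (h' - h) ^+ 2; pose a2 := 8 * (1 + dl) * (1 + dl^-1).
  have a20 : 0 <= a2 by rewrite !mulr_ge0// addr_ge0// ltW.
  have j1 := integrableRZl a1 measurableT il.
  have j2 := integrableRZl a2 measurableT iqq.
  have j12 := integrableRD measurableT j1 j2.
  apply: (@le_trans _ _ (\int[P0]_x (a1 * l x ^+ 2 + a2 * q x))).
    apply: le_Rintegral_restrict => //.
    + by apply: measurable_funX; exact: measurable_funB.
    + by move=> x; rewrite addr_ge0// mulr_ge0 ?sqr_ge0// mulr_ge0 ?sqr_ge0.
    + move=> x [Gx Gx']; rewrite sqr_ge0/=.
      exact: (on_bound_ge (l x) h h' d0 (r0 x) (r'0 x) Gx Gx').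
  rewrite RintegralD// (RintegralZl a1 measurableT il) (RintegralZl a2 measurableT iqq) hI0.
  by have := ler_wpM2l a20 IqD; rewrite /a1 /a2; clear; lra.
Qed.

End moments.

(** * Local ratios of the model and truncation of the score *)

Section local_model.
Context (d : measure_display) (X : measurableType d) (R : realType).

(* [r] is a density of the part of [P1] dominated by [P0]; mass of [P1] that
   is singular to [P0] only increases the risk and is dropped. *)
Definition is_local_ratio (P0 P1 : probability X R) (l : X -> R) (h D : R)
    (r : X -> R) : Prop :=
  [/\ measurable_fun setT r, (forall x, 0 <= r x),
    (forall f : X -> \bar R, measurable_fun setT f -> (forall x, 0 <= f x)%E ->
       (\int[P0]_x ((r x)%:E * f x) <= \int[P1]_x f x)%E),
    P0.-integrable setT (EFin \o r) /\ 1 - D <= \int[P0]_x r x <= 1 &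
    P0.-integrable setT (EFin \o (fun x => ratio_rem l r h x ^+ 2)) /\
    \int[P0]_x (ratio_rem l r h x ^+ 2) <= D].

Lemma dqm0_local_ratio (Theta : set R) (P : R -> probability X R) (score : X -> R) :
  nbhs 0 Theta -> dqm0 Theta P score ->
  forall eta, 0 < eta -> exists2 hb, 0 < hb & forall h, 0 < `|h| < hb ->
    Theta h /\ exists r, is_local_ratio (P 0) (P h) score h (eta * h ^+ 2) r.
Proof.
move=> hTheta [msc [mu [p0 [p1 [dens hlim]]]]] eta eta0.
pose D h := (\int[mu h]_x ((Num.sqrt (p1 h x) - Num.sqrt (p0 h x)
                     - 2^-1 * h * score x * Num.sqrt (p0 h x)) ^+ 2)%:E)%E.
have D0 h : (0 <= D h)%E by apply: integral_ge0 => x _; rewrite lee_fin sqr_ge0.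
have [hb hb0 Hb] : exists2 hb, 0 < hb & forall h, 0 < `|h| < hb ->
    Theta h /\ (D h <= (eta * h ^+ 2)%:E)%E.
  move/fine_cvgP: hlim => [hfin hlim].
  have near1 : \forall h \near 0^', (D h * (h ^- 2)%:E)%E \is a fin_num /\
      `|fine (D h * (h ^- 2)%:E)%E| < eta.
    near=> h; split; first by near: h; exact: hfin.
    near: h; move/cvgrPdist_lt : hlim => /(_ _ eta0); apply: filterS => h.
    by rewrite /= sub0r normrN.
  have near2 : nbhs 0 (fun h => Theta h /\ (h != 0 ->
      (D h * (h ^- 2)%:E)%E \is a fin_num /\ `|fine (D h * (h ^- 2)%:E)%E| < eta)).
    by apply: filterI => //; exact: near1.
  have /nbhs_ballP[hb /= hb0 sub] := near2.
  exists hb => // h /andP[h0 hhb].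
  have : ball (0 : R) hb h by rewrite /ball/= sub0r normrN.
  move=> /sub[Th] /(_ _)[|Dfin Dlt]; first by rewrite -normr_gt0.
  split => //.
  have h2 : 0 < h ^- 2 by rewrite invr_gt0 exprn_even_gt0//= -normr_gt0.
  have Dh : D h \is a fin_num.
    move: Dfin; case: (D h) (D0 h) => [x| |]//= _; by rewrite gt0_mulye ?lte_fin.
  rewrite -(fineK Dh) lee_fin; move: Dlt.
  rewrite -(fineK Dh) -EFinM/= ger0_norm; last first.
    by rewrite mulr_ge0 ?(ltW h2)// fine_ge0.
  rewrite ltr_pdivrMr ?exprn_even_gt0//= -?normr_gt0//.
  exact: ltW.
exists hb => // h hh; have [Th DhE] := Hb _ hh; split => //.
have [dp0 dp1] := dens _ Th.
have [mp0 p00 _] := dp0; have [mp1 p10 _] := dp1.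
pose r := lratio (p0 h) (p1 h).
have mr : measurable_fun setT r by exact: (measurable_lratio dp0 dp1).
have r0 x : 0 <= r x by exact: (lratio_ge0 dp0 dp1).
have dom := lratio_dominated dp0 dp1.
have E := lratio_dqm h dp0 dp1 msc.
have mrE : measurable_fun setT (EFin \o r) by exact/measurable_EFinP.
have mq : measurable_fun setT (fun x => (ratio_rem score r h x ^+ 2)%:E).
  by apply/measurable_EFinP; apply: measurable_funX; exact: (measurable_lratio_rem h dp0 dp1 msc).
have Er1 : (\int[P 0%R]_x (r x)%:E <= 1)%E.
  have := dom (cst 1%E) (measurable_cst _) (fun=> lee01).
  have -> : (\int[P h]_x cst 1 x = 1)%E.
    by rewrite integral_cst// mul1e; exact: probability_setT.
  by under eq_integral do rewrite mule1.
have Er0 : (0 <= \int[P 0%R]_x (r x)%:E)%E.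
  by apply: integral_ge0 => x _; rewrite lee_fin.
have Eq0 : (0 <= \int[P 0%R]_x (ratio_rem score r h x ^+ 2)%:E)%E.
  by apply: integral_ge0 => x _; rewrite lee_fin sqr_ge0.
rewrite -/r -/(D h) in E.
have ir : (P 0).-integrable setT (EFin \o r).
  apply/integrableP; split => //.
  under eq_integral do rewrite gee0_abs ?lee_fin//.
  by rewrite (le_lt_trans Er1)// ltry.
have rfin : (\int[P 0%R]_x (r x)%:E \is a fin_num)%E.
  by rewrite ge0_fin_numE// (le_lt_trans Er1)// ltry.
have Dfin : D h \is a fin_num.
  by rewrite ge0_fin_numE// (le_lt_trans DhE)// ltry.
(* Finiteness is read off the identity of [lratio_dqm] itself; only then can it be rearranged over
   the reals. *)
have qfin : (\int[P 0%R]_x (ratio_rem score r h x ^+ 2)%:E \is a fin_num)%E.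
  rewrite ge0_fin_numE//; apply: (@le_lt_trans _ _ (1 + D h)%E).
    by rewrite (le_trans _ (leeD2r _ Er1))// -E leeDl.
  by rewrite -(fineK Dfin) ltry.
have iq : (P 0).-integrable setT (EFin \o (fun x => ratio_rem score r h x ^+ 2)).
  apply/integrableP; split => //.
  under eq_integral do rewrite gee0_abs ?lee_fin ?sqr_ge0//.
  by rewrite ltey_eq qfin.
move: E DhE Er1 Eq0 Er0; rewrite -(fineK rfin) -(fineK qfin) -(fineK Dfin) -!EFinD !lee_fin.
move=> -[E] DhE Er1 Eq0 Er0.
exists r; split => //.
- by split => //; rewrite /Rintegral; apply/andP; split => //; lra.
- by split => //; rewrite /Rintegral; move: E; lra.
Unshelve. all: by end_near. Qed.

(** Dominated convergence with bound l^2, along integer levels. *)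
Lemma tail_sq_cvg0 (P0 : probability X R) (l : X -> R) (eta : R) :
  measurable_fun setT l ->
  P0.-integrable setT (EFin \o (fun x => l x ^+ 2)) -> 0 < eta ->
  exists2 M, 0 <= M & \int[P0]_x tail_sq M (l x) <= eta.
Proof.
move=> ml il eta0.
pose f n x := (tail_sq (n%:R : R) (l x))%:E.
have mf n : measurable_fun setT (f n).
  by apply/measurable_EFinP; exact: measurable_tail_sq.
have cf x : setT x -> f ^~ x @ \oo --> (cst 0%E : X -> \bar R) x.
  move=> _; apply: cvg_near_cst; near=> n.
  rewrite /f /tail_sq ifF//; apply/negbTE; rewrite -leNgt.
  by near: n; exact: nbhs_infty_ger.
have ig x n : setT x -> (`|f n x| <= (l x ^+ 2)%:E)%E.
  by move=> _; rewrite /= lee_fin ger0_norm ?tail_sq_ge0 ?tail_sq_le.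
have [_ _] := @dominated_convergence _ _ _ P0 setT measurableT f (cst 0%E)
  (EFin \o (fun x => l x ^+ 2)) mf (measurable_cst _) (aeW _ cf) il (aeW _ ig).
rewrite integral_cst// mul0e => /fine_cvgP[_ /cvgrPdist_le/(_ _ eta0)] [N _ HN].
exists N%:R => //; have := HN N (leqnn N).
by rewrite /= sub0r normrN; apply: le_trans; exact: ler_norm.
Unshelve. all: by end_near. Qed.

End local_model.

(** * Two-point lower bound *)

Section two_point.
Context (d : measure_display) (X : measurableType d) (R : realType).

Lemma gcdf_lip (x y : R) : x <= y -> gcdf y - gcdf x <= y - x.
Proof.
rewrite le_eqVlt => /predU1P[->|xy]; first by rewrite !subrr.
have [z _||c _ ->] := @MVT _ gcdf gpdf _ _ xy.
- exact: is_derive_gcdf.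
- exact/continuous_subspaceT/continuous_gcdf.
- by rewrite ler_piMl ?subr_ge0 ?gpdf_le1// ltW.
Qed.

Lemma is_local_ratioW (P0 P1 : probability X R) (l r : X -> R) (h D D' : R) :
  D <= D' -> is_local_ratio P0 P1 l h D r -> is_local_ratio P0 P1 l h D' r.
Proof.
move=> DD' [mr r0 dom [ir /andP[r1 r2]] [iq qD]]; split => //; split => //; last lra.
by apply/andP; split => //; lra.
Qed.

(* The order of the choices: first [dl], then the truncation level [M] of the
   score, then [eta], then [n]. *)
Lemma step_err_small (e g s0 T1 B : R) : 0 < e -> 0 < g -> 0 < s0 -> 0 < T1 -> 0 < B ->
  exists2 dl, 0 < dl <= 8^-1 & 8 * dl * T1 <= g /\
  exists2 eps1, 0 < eps1 & forall M K I0 : R, 0 <= M -> K <= eps1 -> 0 <= I0 ->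
  exists2 eta, 0 < eta & 16 * (1 + dl) * (1 + dl^-1) * (eta * B) <= g / 2 /\
  forall c : R, exists N, forall n, (N <= n)%N -> [/\ (0 < n)%N, c <= n%:R &
    n%:R * step_err s0 dl (T1 / n%:R)
      (eta * B / n%:R + off_bound dl M (B / n%:R) K I0 (2 * (eta * B / n%:R))) <= e].
Proof.
move=> e0 g0 s00 T10 B0.
have si0 : 0 < s0^-1 by rewrite invr_gt0.
have [k1 k1E] : {x | x = T1 * (2 * (2 + 4 / s0) / s0)} by eexists.
have k10 : 0 < k1 by rewrite k1E !mulr_gt0// addr_gt0// mulr_gt0.
(* The second term lets the slack g absorb the passage from (1 + dl)^2 T to (1 - dl) (T + g); the
   third gives the curvature excess in [step_err] at most e / 4 over n steps. *)
pose dl := Num.min 8^-1 (Num.min (g / (8 * T1)) (e / (4 * k1))).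
have k14 : 0 < 4 * k1 by rewrite mulr_gt0.
have T18 : 0 < 8 * T1 by rewrite mulr_gt0.
have dl0 : 0 < dl by rewrite !lt_min invr_gt0 ltr0n !divr_gt0.
have dl8 : dl <= 8^-1 by rewrite /dl ge_min lexx.
have dlg : dl <= g / (8 * T1) by rewrite /dl !ge_min lexx orbT.
have dlk : dl <= e / (4 * k1) by rewrite /dl !ge_min lexx !orbT.
exists dl; first by rewrite dl0.
split; first by move: dlg; rewrite ler_pdivlMr ?mulr_gt0//; lra.
have {dlk} dlk : dl * k1 <= e / 4.
  by move: dlk; rewrite ler_pdivlMr ?mulr_gt0//; lra.
have id20 : 0 < (dl ^+ 2)^-1 by rewrite invr_gt0 exprn_gt0.
have id0 : 0 < dl^-1 by rewrite invr_gt0.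
have [C1 C1E] : {x | x = 2 * (2 + 18 / dl ^+ 2)} by eexists.
have C10 : 0 < C1 by rewrite C1E mulr_gt0// addr_gt0// mulr_gt0.
exists (e / (32 * C1 * B)); first by rewrite divr_gt0// !mulr_gt0.
move=> M K I0 M0; rewrite ler_pdivlMr ?mulr_gt0// => hK I00.
have [k2 k2E] : {x | x = 16 * (1 + dl) * (1 + dl^-1)} by eexists.
have k20 : 0 < k2 by rewrite k2E !mulr_gt0//; lra.
pose u := Num.min (e / 32) (Num.min (e / (192 * C1)) (g / (2 * k2))).
have u0 : 0 < u by rewrite !lt_min !divr_gt0 ?mulr_gt0.
have ue : u <= e / 32 by rewrite /u ge_min lexx.
have uC : u <= e / (192 * C1) by rewrite /u !ge_min lexx orbT.
have uk : u <= g / (2 * k2) by rewrite /u !ge_min lexx !orbT.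
have {uC} uC : C1 * u <= e / 192.
  by move: uC; rewrite ler_pdivlMr ?mulr_gt0//; clear; lra.
have uB : u / B * B = u by rewrite divfK ?gt_eqF.
exists (u / B); first by rewrite divr_gt0.
rewrite uB; split.
  by move: uk; rewrite -k2E ler_pdivlMr ?mulr_gt0//; lra.
move=> c.
(* b1, b2, b3, divided by n, are the parts that vanish as n grows, scaled so that being at most 1
   suffices. Then four terms of at most e / 32 (192 being 6 times 32) are doubled to e / 4, and with
   e / 4 each from the dl and t^2 terms the total is 3 e / 4. *)
pose b1 := 18 * B * M ^+ 2 / dl ^+ 2.
pose b2 := C1 * (B ^+ 2 * (9 * M ^+ 2 / dl ^+ 2) * I0) * (32 / e).
pose b3 := T1 ^+ 2 * (s0 ^- 3 + s0^-1) * (4 / e).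
have M2 := sqr_ge0 M.
have b10 : 0 <= b1 by rewrite !mulr_ge0// ltW.
have ie0 : 0 < e^-1 by rewrite invr_gt0.
have b20 : 0 <= b2.
  apply: mulr_ge0; last by rewrite mulr_ge0// ltW.
  apply: mulr_ge0; first exact: ltW.
  by rewrite !mulr_ge0 ?sqr_ge0// ltW.
have b30 : 0 <= b3.
  apply: mulr_ge0; last by rewrite mulr_ge0// ltW.
  by rewrite mulr_ge0 ?sqr_ge0// addr_ge0// ?(ltW si0)// invr_ge0 exprn_ge0// ltW.
have [N _ HN] := nbhs_infty_ger (Num.max c 0 + 1 + b1 + b2 + b3).
exists N => n /HN /= hn.
have c0 : 0 <= Num.max c 0 by rewrite le_max lexx orbT.
have cc : c <= Num.max c 0 by rewrite le_max lexx.
set c' := Num.max c 0 in hn c0 cc.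
have n0 : 0 < n%:R :> R by move: hn c0 b10 b20 b30; clear; lra.
have i0 : 0 < (n%:R : R)^-1 by rewrite invr_gt0.
split; [by rewrite -(ltr0n R)|by move: hn cc b10 b20 b30; clear; lra|].
have [n1 n2 n3] : [/\ b1 / n%:R <= 1, b2 / n%:R <= 1 & b3 / n%:R <= 1].
  by split; rewrite ler_pdivrMr//; move: hn c0 b10 b20 b30; clear; lra.
have nn : (n%:R : R) != 0 by rewrite gt_eqF.
have dn : dl != 0 by rewrite gt_eqF.
have sn : s0 != 0 by rewrite gt_eqF.
have -> : n%:R * step_err s0 dl (T1 / n%:R)
      (u / n%:R + off_bound dl M (B / n%:R) K I0 (2 * (u / n%:R))) =
  2 * (u + C1 * (B * K) + (e / 32) * (b2 / n%:R) + C1 * (2 + b1 / n%:R) * (2 * u))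
  + dl * k1 + e / 4 * (b3 / n%:R).
  rewrite /step_err /off_bound -C1E k1E /b1 /b2 /b3.
  by field; rewrite nn sn dn gt_eqF.
have h1 : C1 * (B * K) <= e / 32 by move: hK; clear; lra.
have h2 : (e / 32) * (b2 / n%:R) <= e / 32 by rewrite ler_piMr// divr_ge0// ltW.
have h3 : e / 4 * (b3 / n%:R) <= e / 4 by rewrite ler_piMr// divr_ge0// ltW.
have h4 : C1 * (2 + b1 / n%:R) * (2 * u) <= 6 * (C1 * u).
  have : C1 * u * (b1 / n%:R) <= C1 * u by rewrite ler_piMr// mulr_ge0 ?ltW.
  by clear; lra.
by move: e0 h1 h2 h3 h4 uC ue dlk; clear; lra.
Qed.

Lemma two_point_lower_bound (Theta : set R) (P : R -> probability X R)
    (score : X -> R) (I0 : R) :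
  nbhs 0 Theta -> dqm0 Theta P score ->
  fisher_information (P 0) score = I0%:E ->
  forall T B e : R, 0 <= T -> 0 < B -> 0 < e -> exists N, forall n, (N <= n)%N ->
  forall h h', h != 0 -> h' != 0 -> n%:R * h ^+ 2 <= B -> n%:R * h' ^+ 2 <= B ->
  n%:R * (h' - h) ^+ 2 * I0 <= T ->
  [/\ Theta h, Theta h' & forall phi : n.-tuple X -> R, is_test phi ->
    ((2 * (1 - gcdf (Num.sqrt T / 2)) - e)%:E <=
      \int[iid (P h) n]_x (phi x)%:E + \int[iid (P h') n]_x (1 - phi x)%:E)%E].
Proof.
move=> hTheta hdqm hI0 T B e T0 B0 e0.
have ml : measurable_fun setT score by case: hdqm.
have I00 : 0 <= I0.
  by rewrite -lee_fin -hI0; apply: integral_ge0 => x _; rewrite lee_fin sqr_ge0.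
have il : (P 0).-integrable setT (EFin \o (fun x => score x ^+ 2)).
  apply/integrableP; split; first by apply/measurable_EFinP; exact: measurable_funX.
  under eq_integral do rewrite gee0_abs ?lee_fin ?sqr_ge0//.
  by rewrite [X in (X < _)%E]hI0 ltry.
have RI0 : \int[P 0%R]_x (score x ^+ 2) = I0 by rewrite /Rintegral [X in fine X]hI0.
(* The slack s1^2 - T = 2 g is shared equally between the initial variance s0^2 and the excess of T1
   over T, so the final scale is s1. Replacing s1 by sqrt T costs 2 (e / 4), and the accumulated
   step errors cost 2 (e / 4). *)
pose s1 := Num.sqrt T + e / 2.
have sT0 : 0 <= Num.sqrt T by exact: sqrtr_ge0.
have s10 : 0 < s1 by rewrite /s1; lra.
have s1T : T < s1 ^+ 2.
  by rewrite -[ltLHS](sqr_sqrtr T0) ltr_pXn2r ?nnegrE ?(ltW s10)// /s1; lra.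
pose g := (s1 ^+ 2 - T) / 2; have g0 : 0 < g by rewrite /g; lra.
pose T1 := T + g; have T10 : 0 < T1 by rewrite /T1; lra.
pose s0 := Num.sqrt g; have s00 : 0 < s0 by rewrite sqrtr_gt0.
have e40 : 0 < e / 4 by lra.
have [dl /andP[dl0 dl8] [dlT [eps1 eps10]]] := step_err_small e40 g0 s00 T10 B0.
have [M M0 KM] := tail_sq_cvg0 ml il eps10.
move=> /(_ M _ I0 M0 KM I00) [eta eta0 [etag HN]].
have [hb hb0 Hb] := dqm0_local_ratio hTheta hdqm eta0.
(* For such n, h^2 <= B / n < hb^2, so both parameters lie in the local neighborhood. *)
have [N {}HN] := HN (B / hb ^+ 2 + 1).
exists N => n /HN[ngt nB err] h h' h0 h'0 hB h'B hT.
have n0 : 0 < n%:R :> R by rewrite ltr0n.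
have small k : k != 0 -> n%:R * k ^+ 2 <= B -> [/\ 0 < `|k| < hb, k ^+ 2 <= B / n%:R &
    eta * k ^+ 2 <= eta * B / n%:R].
  move=> k0 kB; have k2 : k ^+ 2 <= B / n%:R by rewrite ler_pdivlMr// mulrC.
  split => //; last by rewrite -mulrA ler_pM2l.
  rewrite normr_gt0 k0/=.
  rewrite -(ltr_pXn2r (ltn0Sn 1)) ?nnegrE ?(ltW hb0)//.
  rewrite real_normK ?num_real//; apply: le_lt_trans k2 _.
  rewrite ltr_pdivrMr// mulrC -ltr_pdivrMr ?exprn_gt0//; lra.
have [hhb hm hD] := small h h0 hB; have [h'hb h'm h'D] := small h' h'0 h'B.
have [Th [r lr]] := Hb _ hhb; have [Th' [r' lr']] := Hb _ h'hb.
split => // phi tphi.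
have {lr}[mr r0 dom [ir r1] [iq qD]] := is_local_ratioW hD lr.
have {lr'}[mr' r'0 dom' [ir' r'1] [iq' q'D]] := is_local_ratioW h'D lr'.
have dl1 : dl <= 1 by clear -dl8; lra.
have [M1 M2 M3] := near1_moments ml il RI0 mr mr' r0 r'0 ir ir' iq iq' qD q'D r1 r'1
  dl0 dl1 M0 hm h'm.
set al := near1_err _ _ _ _ _ _ _ in M1 M2.
have tau0 : 0 <= T1 / n%:R by rewrite divr_ge0 ?ltW.
have al0 : 0 <= al by apply: le_trans M2.
have M3' : \int[P 0%R]_(x in near1 dl r r') ((r' x - r x) ^+ 2) <= (1 - dl) * (T1 / n%:R).
  apply: le_trans M3 _; rewrite [leRHS]mulrA ler_pdivlMr//.
  have -> : ((1 + dl) ^+ 2 * (h' - h) ^+ 2 * I0 +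
      16 * (1 + dl) * (1 + dl^-1) * (eta * B / n%:R)) * n%:R =
    (1 + dl) ^+ 2 * (n%:R * (h' - h) ^+ 2 * I0) + 16 * (1 + dl) * (1 + dl^-1) * (eta * B).
    by field; rewrite !gt_eqF.
  have : (1 + dl) ^+ 2 * (n%:R * (h' - h) ^+ 2 * I0) <= (1 + dl) ^+ 2 * T.
    by rewrite ler_wpM2l// sqr_ge0.
  have : (1 + dl) ^+ 2 * T <= (1 + 3 * dl) * T.
    rewrite ler_wpM2r//; have : dl * dl <= dl by rewrite ler_piMl// ltW.
    by clear - dl0; lra.
  rewrite /T1 in dlT *; have : 0 <= dl * g by rewrite mulr_ge0 ?ltW.
  have : 0 <= dl * T by rewrite mulr_ge0// ltW.
  by move: dlT etag; clear; lra.
have := weighted_risk_ge mr mr' r0 r'0 dom dom' s00 dl0 dl8 tau0 al0 M1 M2 M3' ler01 ler01 tphi.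
rewrite /weighted_risk !mul1e; apply: le_trans; rewrite lee_fin.
have -> : s0 ^+ 2 + n%:R * (T1 / n%:R) = s1 ^+ 2.
  rewrite sqr_sqrtr ?(ltW g0)// mulrC divfK ?gt_eqF// /T1 /g; clear; lra.
rewrite sqrtr_sqr (gtr0_norm s10) /overlap !ltr01/= mul1r divr1 ln1 goverlap0.
have gl : gcdf (s1 / 2) - gcdf (Num.sqrt T / 2) <= s1 / 2 - Num.sqrt T / 2.
  by apply: gcdf_lip; rewrite /s1; clear -e0; lra.
have s1E : s1 / 2 - Num.sqrt T / 2 = e / 4 by rewrite /s1; field.
rewrite s1E in gl; rewrite -/(near1_err _ _ _ _ _ _ _) -/al in err.
by move: err gl; clear; lra.
Qed.

End two_point.

(** * Minimax risk and confidence intervals *)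

Section ereal_limits.
Context {R : realType}.
Local Open Scope ereal_scope.
Implicit Types u : (\bar R)^nat.

Lemma cvge_to1 u : (forall n, (0 < n)%N -> u n <= 1) ->
  (forall e : R, (0 < e)%R -> exists N, forall n, (N <= n)%N -> (1 - e)%:E <= u n) ->
  u n @[n --> \oo] --> 1.
Proof.
move=> u1 ue.
have ub e : (0 < e)%R -> exists N, forall n, (N <= n)%N ->
    u n \is a fin_num /\ (1 - e <= fine (u n) <= 1)%R.
  move=> e0; have [N HN] := ue _ e0.
  exists (maxn N 1) => n; rewrite geq_max => /andP[/HN un /u1 un1].
  have uf : u n \is a fin_num.
    rewrite fin_numE -ltNye -ltey (lt_le_trans (ltNyr _) un).
    by rewrite (le_lt_trans un1) ?ltry.
  by split => //; rewrite -!lee_fin fineK// un un1.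
apply/fine_cvgP; split.
  by have [N HN] := ub _ ltr01; exists N => // n /= /HN[].
apply/cvgrPdist_le => e e0; have [N HN] := ub _ e0.
exists N => // n /= /HN[_ /andP[h1 h2]].
by rewrite ger0_norm ?subr_ge0//; lra.
Qed.

Lemma limn_einf_ge u (v : R) :
  (forall e : R, (0 < e)%R -> exists N, forall n, (N <= n)%N -> (v - e)%:E <= u n) ->
  v%:E <= limn_einf u.
Proof.
move=> ue; apply/lee_addgt0Pr => e e0.
have [N HN] := ue _ e0.
suff : (v - e)%:E <= limn_einf u by rewrite -leeBlDr// EFinB.
rewrite limn_einf_lim; apply: lime_ge; first exact: is_cvg_einfs.
exists N => // n /= Nn; apply: le_ereal_inf_tmp => _ [m /= nm <-].
by apply: HN; exact: leq_trans nm.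
Qed.

Lemma limn_esup_lt u (e : \bar R) : limn_esup u < e ->
  exists N, forall n, (N <= n)%N -> u n < e.
Proof.
move=> /ereal_inf_lt[_ [A [N _ NA] <-] Ae]; exists N => n Nn.
by apply: le_lt_trans Ae; apply: ereal_sup_ubound; exists n => //; exact: NA.
Qed.

End ereal_limits.

Section classes.
Context {R : realType}.
Local Open Scope ereal_scope.
Implicit Types (A : set R) (f : R -> \bar R).

Lemma sup_class_ge A f t : A t -> f t <= sup_class A f.
Proof.
move=> At; rewrite /sup_class; case: ifPn => [/eqP A0|_]; first by rewrite A0 in At.
by apply: ereal_sup_ubound; exists t.
Qed.

Lemma sup_class_le A f v : 0 <= v -> (forall t, A t -> f t <= v) -> sup_class A f <= v.
Proof.
move=> v0 fv; rewrite /sup_class; case: ifPn => // _.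
by apply: ge_ereal_sup => _ [t At <-]; exact: fv.
Qed.

Lemma inf_class_le1 A f : (forall t, A t -> f t <= 1) -> inf_class A f <= 1.
Proof.
move=> f1; rewrite /inf_class; case: ifPn => // /set0P[t At].
by apply: ereal_inf_le; exists (f t); [exists t|exact: f1].
Qed.

Lemma inf_class_ge A f v : v <= 1 -> (forall t, A t -> v <= f t) -> v <= inf_class A f.
Proof.
move=> v1 fv; rewrite /inf_class; case: ifPn => // _.
by apply: le_ereal_inf_tmp => _ [t At <-]; exact: fv.
Qed.

End classes.

Section powers.
Context {R : realType}.

Lemma npow_half n : npow (- 2^-1 : R) n.+1 = (Num.sqrt n.+1%:R)^-1.
Proof. by rewrite /npow powRN powR12_sqrt. Qed.

Lemma npow_gt0 (a : R) n : (0 < n)%N -> 0 < npow a n.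
Proof. by move=> n0; rewrite powR_gt0// ltr0n. Qed.

Lemma npowD (a b : R) n : (0 < n)%N -> npow (a + b) n = npow a n * npow b n.
Proof. by move=> n0; rewrite /npow powRD// pnatr_eq0 gtn_eqF// implybT. Qed.

Lemma cvg_npow_y (a : R) : 0 < a -> npow a n @[n --> \oo] --> +oo.
Proof.
move=> a0; apply/cvgryPge => A.
pose B := Num.max A 1.
have B1 : 1 <= B by rewrite le_max lexx orbT.
have BA : A <= B by rewrite le_max lexx.
near=> n; apply: le_trans BA _.
have -> : B = (B `^ a^-1) `^ a.
  by rewrite -powRrM mulVf ?gt_eqF// powRr1//; lra.
rewrite /npow ge0_ler_powR ?nnegrE ?powR_ge0 ?(ltW a0)//.
by near: n; exact: nbhs_infty_ger.
Unshelve. all: by end_near. Qed.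

End powers.

(** * Lower bounds for the minimax risk *)

Section minimax.
Context (d : measure_display) (X : measurableType d) (R : realType).
Variables (Theta : set R) (P : R -> probability X R) (score : X -> R) (I0 eps : R).
Hypotheses (hTheta : nbhs 0 Theta) (hdqm : dqm0 Theta P score).
Hypothesis hI0 : fisher_information (P 0) score = I0%:E.
Hypothesis heps : 0 < eps < 1.

Lemma minimax_risk_le1 Delta n : (minimax_risk Theta P eps Delta n <= 1)%E.
Proof.
apply: ereal_inf_le.
exists (test_risk Theta P eps (Delta n) (fun=> 0 : R) (n := n)).
  exists (fun=> 0) => //; split; first exact: measurable_cst.
  by move=> x; rewrite lexx ler01.
rewrite /test_risk -[leRHS]add0e leeD//.
  by apply: sup_class_le => // t _; rewrite integral0.
apply: sup_class_le => // t _.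
rewrite subr0 integral_cst// mul1e; exact: probability_le1.
Qed.

Lemma minimax_lower_bound (T B e : R) : 0 <= T -> 0 < B -> 0 < e ->
  exists N, forall n, (N <= n)%N -> forall Delta : nat -> R, 0 < Delta n ->
    n%:R * Delta n ^+ 2 <= B -> n%:R * (2 * eps * Delta n) ^+ 2 * I0 <= T ->
    ((2 * (1 - gcdf (Num.sqrt T / 2)) - e)%:E <= minimax_risk Theta P eps Delta n)%E.
Proof.
move=> T0 B0 e0; move: heps => /andP[e1 e2].
(* Both test points are at most 2 * [Delta n], which accounts for the 4. *)
have B40 : 0 < 4 * B by rewrite mulr_gt0.
have [N HN] := two_point_lower_bound hTheta hdqm hI0 T0 B40 e0.
exists N => n /HN {}HN Delta D0 hB hT.
have D2 : 0 <= n%:R * Delta n ^+ 2 by rewrite mulr_ge0 ?sqr_ge0.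
have e1D : 0 < (1 - eps) * Delta n by rewrite mulr_gt0//; lra.
have e2D : 0 < (1 + eps) * Delta n by rewrite mulr_gt0//; lra.
have [|||||Th0 Th1 H] := HN ((1 - eps) * Delta n) ((1 + eps) * Delta n).
- by rewrite gt_eqF.
- by rewrite gt_eqF.
- by rewrite exprMn mulrCA ler_pM ?sqr_ge0//; nra.
- by rewrite exprMn mulrCA ler_pM ?sqr_ge0//; nra.
- by rewrite (_ : _ - _ = 2 * eps * Delta n)//; ring.
apply: le_ereal_inf_tmp => _ [phi tphi <-]; apply: le_trans (H _ tphi) _.
rewrite /test_risk leeD//.
- apply: (sup_class_ge (fun theta => \int[iid (P theta) n]_x (phi x)%:E)%E).
  by split => //; rewrite ger0_norm// ltW.
- apply: (sup_class_ge (fun theta => \int[iid (P theta) n]_x (1 - phi x)%:E)%E).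
  by split => //; rewrite ger0_norm// ltW.
Qed.

Lemma minimax_risk_cvg1 (Delta : nat -> R) : (forall n, (0 < n)%N -> 0 < Delta n) ->
  n%:R * Delta n ^+ 2 @[n --> \oo] --> 0 ->
  minimax_risk Theta P eps Delta n @[n --> \oo] --> 1%E.
Proof.
move=> D0 hD; apply: cvge_to1; first by move=> n _; exact: minimax_risk_le1.
move=> e e0; have e20 : 0 < e / 2 by lra.
have I00 : 0 <= I0.
  by rewrite -lee_fin -hI0; apply: integral_ge0 => x _; rewrite lee_fin sqr_ge0.
pose T := (e / 2) ^+ 2.
have [N HN] := minimax_lower_bound (sqr_ge0 (e / 2)) ltr01 e20.
(* The factor 4 is that of (2 eps)^2 with eps <= 1, and the added 1 keeps the denominator positive.
   With sqrt T = e / 2 the Gaussian term loses at most e / 2. *)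
pose k := Num.min 1 (T / (4 * I0 + 1)).
have k0 : 0 < k by rewrite lt_min ltr01 divr_gt0 ?exprn_gt0//; lra.
have /cvgrPdist_le/(_ _ k0)[N' _ HN'] := hD.
exists (maxn N (maxn N' 1)) => n; rewrite !geq_max => /and3P[Nn N'n n0].
have x0 : 0 <= n%:R * Delta n ^+ 2 by rewrite mulr_ge0 ?sqr_ge0.
have := HN' _ N'n; rewrite /= sub0r normrN ger0_norm//.
rewrite le_min => /andP[kn1]; rewrite ler_pdivlMr; last lra.
move=> knT.
have eps1 : eps ^+ 2 <= 1 by move: heps => /andP[? ?]; rewrite expr_le1//; lra.
have xI : 0 <= n%:R * Delta n ^+ 2 * I0 by rewrite mulr_ge0.
have hT : n%:R * (2 * eps * Delta n) ^+ 2 * I0 <= T.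
  have -> : n%:R * (2 * eps * Delta n) ^+ 2 * I0 = (n%:R * Delta n ^+ 2) * I0 * 4 * eps ^+ 2.
    by ring.
  apply: le_trans (ler_wpM2l _ eps1) _; first by rewrite mulr_ge0.
  by move: knT; rewrite mulr1; lra.
have := HN _ Nn Delta (D0 _ n0) kn1 hT.
apply: le_trans; rewrite lee_fin sqrtr_sqr gtr0_norm//.
have h0 : 0 <= e / 2 / 2 by lra.
by have := gcdf_lip h0; rewrite gcdf0; lra.
Qed.

(** Only an upper bound b on sqrt n Delta_n enters: b = d gives the constant of the local regime,
    and any b gives a positive limit inferior when Delta_n is of order n^(-1/2). *)
Lemma limn_einf_minimax_ge (Delta : nat -> R) (b : R) : 0 < b ->
  (forall n, (0 < n)%N -> 0 < Delta n) ->
  (forall n, (0 < n)%N -> Delta n <= b * npow (- 2^-1) n) ->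
  ((2 * (1 - gcdf (eps * (b * Num.sqrt I0))))%:E
    <= limn_einf (minimax_risk Theta P eps Delta))%E.
Proof.
move=> b0 D0 Db; apply: limn_einf_ge => e e0.
have I00 : 0 <= I0.
  by rewrite -lee_fin -hI0; apply: integral_ge0 => x _; rewrite lee_fin sqr_ge0.
move: (heps) => /andP[e1 e2].
pose T := (2 * eps * (b * Num.sqrt I0)) ^+ 2.
have [N HN] := minimax_lower_bound (sqr_ge0 (2 * eps * (b * Num.sqrt I0))) (exprn_gt0 2 b0) e0.
exists (maxn N 1) => n; rewrite geq_max => /andP[Nn n0].
have nD : n%:R * Delta n ^+ 2 <= b ^+ 2.
  have := Db _ n0; have := D0 _ n0; case: n n0 {Nn} => // n _ Dn.
  rewrite npow_half => h.
  have : Delta n.+1 ^+ 2 <= (b / Num.sqrt n.+1%:R) ^+ 2.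
    by rewrite ler_pXn2r// nnegrE ltW// divr_gt0// sqrtr_gt0.
  rewrite expr_div_n sqr_sqrtr// ler_pdivlMr// mulrC//.
have := HN _ Nn Delta (D0 _ n0) nD.
rewrite sqrtr_sqr ger0_norm; last by rewrite !mulr_ge0 ?sqrtr_ge0//; lra.
have -> : 2 * eps * (b * Num.sqrt I0) / 2 = eps * (b * Num.sqrt I0) by field.
apply.
have -> : n%:R * (2 * eps * Delta n) ^+ 2 * I0 =
  (4 * eps ^+ 2 * I0) * (n%:R * Delta n ^+ 2) by ring.
have -> : (2 * eps * (b * Num.sqrt I0)) ^+ 2 = (4 * eps ^+ 2 * Num.sqrt I0 ^+ 2) * b ^+ 2 by ring.
by rewrite sqr_sqrtr// ler_wpM2l// mulr_ge0// mulr_ge0// sqr_ge0.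
Qed.

Lemma not_consistently_classifiable (Delta : nat -> R) :
  (0 < limn_einf (minimax_risk Theta P eps Delta))%E ->
  ~ consistently_classifiable Theta P eps Delta.
Proof.
move=> pos [phi [tphi cv]]; move: pos; apply/negP; rewrite -leNgt.
rewrite -(cvg_limn_einf_sup cv).1 !limn_einf_lim.
apply: lee_lim; [exact: is_cvg_einfs|exact: is_cvg_einfs|].
apply: nearW => n; apply: le_ereal_inf_tmp => _ [m /= nm <-].
apply: le_trans (ereal_inf_lbound _) _; first by exists m; [exact: nm|reflexivity].
by apply: ereal_inf_lbound; exists (phi m) => //; exact: tphi.
Qed.

End minimax.

(** * Confidence intervals in the resolvable regime *)

Section resolution.
Context (d : measure_display) (X : measurableType d) (R : realType).
Variables (Theta : set R) (P : R -> probability X R) (eps : R).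

Lemma measurable_preimage_itv n (f : n.-tuple X -> R) (i : interval R) :
  measurable_fun setT f -> measurable (f @^-1` [set` i]).
Proof.
by move=> mf; rewrite -[X in measurable X]setTI; apply: mf => //; exact: measurable_itv.
Qed.

Lemma prob_ge_compl n (Q : probability (n.-tuple X) R) (A B : set (n.-tuple X)) (e : R) :
  measurable A -> measurable B -> ~` B `<=` A -> (Q B <= e%:E)%E ->
  ((1 - e)%:E <= Q A)%E.
Proof.
move=> mA mB BA QB; apply: (@le_trans _ _ (Q (~` B))).
  rewrite probability_setC// EFinB; apply: leeB => //.
by apply: le_measure => //; rewrite inE//; exact: measurableC.
Qed.

(** Expressing the event through the estimator alone makes it measurable and comparable with the
    deviation event; nonnegativity of c * s n puts both endpoints in the interval. *)
Lemma conf_itv_subset_regionE n (T : forall n, n.-tuple X -> R) (s : nat -> R) (c Delta : R) :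
  0 <= c * s n ->
  [set x : n.-tuple X | conf_itv T s c x `<=` region Delta] =
    T n @^-1` `[- Delta + c * s n, Delta - c * s n].
Proof.
move=> cs; apply/seteqP; split=> x /=; rewrite /conf_itv /region in_itv/=.
  move=> sub; have /= := sub (T n x - c * s n); have /= := sub (T n x + c * s n).
  rewrite !in_itv/= => h1 h2.
  have /andP[h3 h4] : - Delta <= T n x + c * s n <= Delta by apply: h1; apply/andP; split; lra.
  have /andP[h5 h6] : - Delta <= T n x - c * s n <= Delta by apply: h2; apply/andP; split; lra.
  by apply/andP; split; lra.
move=> /andP[h1 h2] y /=; rewrite !in_itv/= => /andP[h3 h4].
by apply/andP; split; lra.
Qed.

Lemma conf_itv_disjoint_regionE n (T : forall n, n.-tuple X -> R) (s : nat -> R) (c Delta : R) :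
  0 <= c * s n -> 0 <= Delta ->
  [set x : n.-tuple X | conf_itv T s c x `&` region Delta = set0] =
    T n @^-1` `]-oo, - Delta - c * s n[ `|` T n @^-1` `]Delta + c * s n, +oo[.
Proof.
move=> cs D0; apply/seteqP; split=> x /=; rewrite /conf_itv /region !in_itv/= ?andbT.
  move=> disj; have [?|h1] := ltP (T n x) (- Delta - c * s n); first by left.
  have [?|h2] := ltP (Delta + c * s n) (T n x); first by right.
  (* The larger left endpoint lies in both intervals as soon as they meet. *)
  pose y := Num.max (T n x - c * s n) (- Delta).
  have : [set` `[T n x - c * s n, T n x + c * s n]] `&`
      [set` `[- Delta, Delta]] `<=` set0 by rewrite disj.
  move=> /(_ y)[]; split; rewrite /= in_itv/= /y le_max lexx ?orbT ge_max; apply/andP; split; lra.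
move=> h; rewrite -subset0 => y [] /=; rewrite !in_itv/= => /andP[h1 h2] /andP[h3 h4].
by case: h => h; lra.
Qed.

(** Both classes keep a distance eps Delta_n from the endpoints of the region, while C_n stays
    within (M + c) s_n of theta when the deviation is at most M s_n. Since s_n <= b / sqrt n, the
    margin eventually exceeds this for each fixed M. *)
Lemma tight_resolves (Delta : nat -> R) (T : forall n, n.-tuple X -> R) (s : nat -> R) (c : R) :
  0 < eps < 1 -> (forall n, (0 < n)%N -> 0 < Delta n) ->
  Num.sqrt n%:R * Delta n @[n --> \oo] --> +oo ->
  is_estimator T -> is_root_n_scale s ->
  uniformly_tight_at_scale Theta P eps Delta T s -> 0 <= c ->
  resolves Theta P eps Delta T s c.
Proof.
move=> /andP[eps0 eps1] D0 hD mT [s0 _ _ [a [b [a0 b0 sb]]]] tight c0.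
pose bad n M theta := [set x : n.-tuple X | M * s n < `|T n x - theta|].
have mbad n M theta : measurable (bad n M theta).
  have := @measurable_preimage_itv n (fun x => `|T n x - theta|) `]M * s n, +oo[.
  rewrite /bad (_ : [set x | _] = (fun x => `|T n x - theta|) @^-1` `]M * s n, +oo[); last first.
    by apply/seteqP; split=> x /=; rewrite in_itv/= andbT.
  apply; apply: measurableT_comp => //.
  by apply: measurable_funB => //; exact: mT.
have key (e : R) : 0 < e -> exists2 M, 0 <= M & exists N, forall n, (N <= n)%N ->
    [/\ (0 < n)%N, (M + c) * s n < eps * Delta n & forall theta,
    (null_class Theta eps (Delta n) `|` alt_class Theta eps (Delta n)) theta ->
    (iid (P theta) n (bad n M theta) <= e%:E)%E].
  move=> e0.
  have : \forall M \near +oo, (limn_esup (fun n => sup_class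
      (null_class Theta eps (Delta n) `|` alt_class Theta eps (Delta n))
      (fun theta => iid (P theta) n (bad n M theta))) < e%:E)%E.
    by apply: (tight [set y | (y < e%:E)%E]); apply: open_nbhs_nbhs; split;
      [exact: open_ereal_lt_ereal|rewrite /= lte_fin].
  move=> [M0 [_ HM]].
  pose M := Num.max (M0 + 1) 0.
  have MM0 : M0 < M by rewrite /M lt_max ltrDl ltr01.
  have M0' : 0 <= M by rewrite /M le_max lexx orbT.
  have [N1 HN1] := limn_esup_lt (HM _ MM0).
  have /cvgryPgt/(_ ((M + c) * b / eps))[N2 _ HN2] := hD.
  exists M => //; exists (maxn N1 (maxn N2 1)) => n; rewrite !geq_max => /and3P[n1 n2 n0].
  split => //.
    have := HN2 _ n2; rewrite /= ltr_pdivrMr// => h.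
    have := sb _ n0 => /andP[_].
    case: n n0 {n1 n2} h => // n _ h; rewrite npow_half invrK => sn.
    have q0 : 0 < Num.sqrt n.+1%:R :> R by rewrite sqrtr_gt0.
    rewrite -(ltr_pM2r q0); apply: le_lt_trans (_ : _ <= (M + c) * b) _.
      by rewrite -mulrA ler_wpM2l// addr_ge0.
    by lra.
  move=> theta Htheta; apply: ltW; apply: le_lt_trans (HN1 _ n1).
  exact: (sup_class_ge (fun theta => iid (P theta) n (bad n M theta))).
split; apply: cvge_to1.
- move=> n n0; have csn : 0 <= c * s n by rewrite mulr_ge0// ltW// s0.
  apply: inf_class_le1 => t _; apply: probability_le1.
  by rewrite conf_itv_subset_regionE//; exact: measurable_preimage_itv.
- move=> e e0; have [M M0 [N HN]] := key e e0; exists N => n /HN[n0 Mc Hbad].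
  have csn : 0 <= c * s n by rewrite mulr_ge0// ltW// s0.
  apply: inf_class_ge => [|t At]; first by rewrite lee_fin; lra.
  rewrite conf_itv_subset_regionE//.
  apply: (prob_ge_compl _ (mbad n M t)); last by apply: Hbad; left.
    exact: measurable_preimage_itv (mT n).
  move=> x /= /negP; rewrite -leNgt in_itv/=.
  case: At => _ /ler_normlP[t1 t2] /ler_normlP[x1 x2].
  by apply/andP; split; lra.
- move=> n n0; have csn : 0 <= c * s n by rewrite mulr_ge0// ltW// s0.
  apply: inf_class_le1 => t _; apply: probability_le1.
  rewrite conf_itv_disjoint_regionE ?(ltW (D0 _ n0))//.
  by apply: measurableU; exact: measurable_preimage_itv (mT n).
- move=> e e0; have [M M0 [N HN]] := key e e0; exists N => n /HN[n0 Mc Hbad].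
  have csn : 0 <= c * s n by rewrite mulr_ge0// ltW// s0.
  have Dn := D0 _ n0.
  apply: inf_class_ge => [|t At]; first by rewrite lee_fin; lra.
  rewrite conf_itv_disjoint_regionE ?(ltW Dn)//.
  apply: (prob_ge_compl _ (mbad n M t)); last by apply: Hbad; right.
    by apply: measurableU; exact: measurable_preimage_itv (mT n).
  move=> x /= /negP; rewrite -leNgt !in_itv/= andbT.
  case: At => _ At /ler_normlP[x1 x2].
  have [t0|t0] := leP 0 t.
    by right; move: At; rewrite ger0_norm//; lra.
  by left; move: At; rewrite ltr0_norm//; lra.
Qed.

End resolution.

Section sequences.
Context {R : realType}.
Implicit Types (Delta s : nat -> R).

Lemma lambda_npowE (I0 : R) Delta n : (0 < n)%N -> 0 <= I0 ->
  lambda I0 Delta n = Num.sqrt I0 * (Delta n / npow (- 2^-1) n).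
Proof.
case: n => // n _ I00; rewrite /lambda npow_half invrK sqrtrM//; ring.
Qed.

Lemma sqr_npow_half n : (0 < n)%N -> n%:R * (npow (- 2^-1) n : R) ^+ 2 = 1.
Proof.
by case: n => // n _; rewrite npow_half exprVn sqr_sqrtr// divff.
Qed.

Lemma sqrt_npow_half n : (0 < n)%N -> Num.sqrt n%:R * (npow (- 2^-1) n : R) = 1.
Proof.
by case: n => // n _; rewrite npow_half divff// gt_eqF// sqrtr_gt0.
Qed.

Lemma littleo_npow_half Delta : Delta =o_\oo npow (- 2^-1) ->
  n%:R * Delta n ^+ 2 @[n --> \oo] --> 0.
Proof.
move=> /eqoP H; apply/cvgrPdist_le => e e0.
have q0 : 0 < Num.sqrt e by rewrite sqrtr_gt0.
have [N _ HN] := H _ q0.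
exists N.+1 => // n /= Nn; have n0 : (0 < n)%N by exact: leq_ltn_trans Nn.
have := HN _ (ltnW Nn) => /= h.
have x0 : 0 <= n%:R * Delta n ^+ 2 by rewrite mulr_ge0 ?sqr_ge0.
rewrite sub0r normrN ger0_norm//.
have : Delta n ^+ 2 <= (Num.sqrt e * `|npow (- 2^-1) n|) ^+ 2.
  by rewrite -[leLHS]real_normK ?num_real// ler_pXn2r// nnegrE mulr_ge0// ltW.
rewrite exprMn sqr_sqrtr ?(ltW e0)// real_normK ?num_real// => h2.
have := ler_wpM2l (ler0n R n) h2; rewrite (mulrCA _ e) sqr_npow_half//.
by rewrite mulr1.
Qed.

End sequences.

Theorem corollary4 (R : realType) (disp : measure_display)
  (X : measurableType disp) (Theta : set R) (P : R -> probability X R)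
  (score : X -> R) (I0 eps : R)
  (hTheta : nbhs 0 Theta)
  (hdqm : dqm0 Theta P score)
  (hI0 : fisher_information (P 0) score = I0%:E)
  (I0_gt0 : 0 < I0)
  (heps : 0 < eps < 1) :
  (forall (d gamma : R), 0 < d ->
    let Delta := fun n : nat => d * npow (- gamma) n in
    asymp (lambda I0 Delta) (npow (2^-1 - gamma)) /\
    (forall s : nat -> R, (forall n, (0 < n)%N -> 0 < s n) ->
      asymp s (npow (- 2^-1)) ->
      asymp (fun n => Delta n / s n) (npow (2^-1 - gamma))) /\
    (2^-1 < gamma ->
      minimax_risk Theta P eps Delta n @[n --> \oo] --> 1%E) /\
    (gamma = 2^-1 ->
      let kappa := d * Num.sqrt I0 in
      [/\ lambda I0 Delta n @[n --> \oo] --> kappa,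
          0 < kappa,
          (2%:E * (1 - Phi (eps * kappa))
             <= limn_einf (minimax_risk Theta P eps Delta))%E,
          (0 < 2%:E * (1 - Phi (eps * kappa)))%E &
          ~ consistently_classifiable Theta P eps Delta]) /\
    (gamma < 2^-1 ->
      forall (T : forall n, n.-tuple X -> R) (s : nat -> R),
      is_estimator T -> is_root_n_scale s ->
      uniformly_tight_at_scale Theta P eps Delta T s ->
      forall c : R, 0 <= c -> resolves Theta P eps Delta T s c)) /\
  (forall Delta : nat -> R, (forall n, (0 < n)%N -> 0 < Delta n) ->
    (Delta =o_\oo npow (- 2^-1) ->
      minimax_risk Theta P eps Delta n @[n --> \oo] --> 1%E) /\
    (asymp Delta (npow (- 2^-1)) ->
      asymp (lambda I0 Delta) (fun=> 1) /\
      (0 < limn_einf (minimax_risk Theta P eps Delta))%E) /\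
    (Num.sqrt n%:R * Delta n @[n --> \oo] --> +oo ->
      forall (T : forall n, n.-tuple X -> R) (s : nat -> R),
      is_estimator T -> is_root_n_scale s ->
      uniformly_tight_at_scale Theta P eps Delta T s ->
      forall c : R, 0 <= c -> resolves Theta P eps Delta T s c)).

Proof.
have [eps0 eps1] : 0 < eps /\ eps < 1 by case/andP: heps.
have sI0 : 0 < Num.sqrt I0 by rewrite sqrtr_gt0.
have pos (x : R) : 0 < 2 * (1 - gcdf x) by rewrite mulr_gt0// subr_gt0 gcdf_lt1.
split; last first.
  move=> Delta D0; split; [|split].
  - move=> /littleo_npow_half; exact: (minimax_risk_cvg1 hTheta hdqm hI0 heps D0).
  - move=> [a [b [a0 b0 Dab]]]; split.
      exists (Num.sqrt I0 * a), (Num.sqrt I0 * b); split; [exact: mulr_gt0..|].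
      move=> n n0; rewrite divr1 lambda_npowE ?(ltW I0_gt0)// !ler_pM2l//.
      exact: Dab.
    apply: lt_le_trans (limn_einf_minimax_ge hTheta hdqm hI0 heps b0 D0 _).
      by rewrite lte_fin.
    by move=> n n0; rewrite -ler_pdivrMr ?npow_gt0//; case/andP: (Dab _ n0).
  - move=> hD T s hT hs tight c c0; exact: (tight_resolves heps D0 hD hT hs tight c0).
move=> d gamma d0 Delta.
have D0 n : (0 < n)%N -> 0 < Delta n by move=> n0; rewrite mulr_gt0// npow_gt0.
have DE n : (0 < n)%N -> Delta n = d * (npow (2^-1 - gamma) n * npow (- 2^-1) n).
  by move=> n0; rewrite /Delta -npowD//; congr (_ * npow _ _); lra.
split; [|split; [|split; [|split]]].
(* For n >= 1 the ratio is constant, so the two bounds coincide. *)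
- exists (Num.sqrt I0 * d), (Num.sqrt I0 * d); split; [exact: mulr_gt0..|].
  move=> n n0; rewrite lambda_npowE ?(ltW I0_gt0)// DE//.
  suff -> : forall x y : R, 0 < x -> 0 < y ->
      Num.sqrt I0 * (d * (x * y) / y) / x = Num.sqrt I0 * d by rewrite ?lexx ?npow_gt0.
  by move=> x y x0 y0; field; rewrite !gt_eqF.
- move=> s s0 [a [b [a0 b0 sab]]]; exists (d / b), (d / a); split; [exact: divr_gt0..|].
  move=> n n0; have := sab _ n0; rewrite DE//.
  have := npow_gt0 (- 2^-1 : R) n0; have := npow_gt0 (2^-1 - gamma) n0; have := s0 _ n0.
  set x := npow _ _; set y := npow _ _; set z := s n => z0 x0 y0 /andP[h1 h2].
  have -> : d * (x * y) / z / x = d * (z / y)^-1 by field; rewrite !gt_eqF.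
  have zy : 0 < z / y by rewrite divr_gt0.
  by rewrite !ler_pM2l// !lef_pV2 ?posrE// h1 h2.
- move=> gamma12; apply: (minimax_risk_cvg1 hTheta hdqm hI0 heps D0).
  (* For n >= 1, n Delta_n^2 is the square of d n^(1/2 - gamma), and that power is the inverse of
     one tending to infinity. *)
  have : (npow (gamma - 2^-1) n)^-1 @[n --> \oo] --> (0 : R).
    apply/gtr0_cvgV0; last by apply: cvg_npow_y; lra.
    by exists 1%N => // n /= n0; exact: npow_gt0.
  move=> h; have dh : d * (npow (gamma - 2^-1) n)^-1 @[n --> \oo] --> d * 0.
    exact: cvgMl_tmp h.
  have := cvgM dh dh; rewrite !mulr0 => /(_ eventually_filter) dd.
  apply: cvg_trans dd; apply: near_eq_cvg.
  exists 1%N => // n /= n0; rewrite DE//.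
  have -> : npow (2^-1 - gamma) n = (npow (gamma - 2^-1) n)^-1 by rewrite /npow -powRN opprB.
  set x := _^-1; have := sqr_npow_half (R := R) n0; set y := npow _ _ => ny.
  have -> : n%:R * (d * (x * y)) ^+ 2 = (n%:R * y ^+ 2) * (d * x) ^+ 2 by ring.
  by rewrite ny mul1r expr2.
- move=> gE kappa.
  have k0 : 0 < kappa by rewrite mulr_gt0.
  have Db n : (0 < n)%N -> Delta n <= d * npow (- 2^-1) n by rewrite /Delta gE.
  have lb := limn_einf_minimax_ge hTheta hdqm hI0 heps d0 D0 Db.
  have PE : (2%:E * (1 - Phi (eps * kappa)))%E = (2 * (1 - gcdf (eps * kappa)))%:E.
    by rewrite Phi_gcdf EFinM EFinB.
  split => //.
  + apply: cvg_near_cst; exists 1%N => // n /= n0.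
    rewrite lambda_npowE ?(ltW I0_gt0)// /Delta gE mulfK ?gt_eqF ?npow_gt0//.
    by rewrite mulrC.
  + by rewrite PE.
  + by rewrite PE lte_fin.
  + apply: not_consistently_classifiable; apply: lt_le_trans lb; by rewrite lte_fin.
- move=> gamma12 T s hT hs tight c c0.
  apply: (tight_resolves heps D0 _ hT hs tight c0).
  have g0 : 0 < 2^-1 - gamma by lra.
  apply/cvgryPge => A; have /cvgryPge/(_ (A / d))[N _ HN] := cvg_npow_y g0.
  exists (maxn N 1) => // n /=; rewrite geq_max => /andP[/HN /= An n0].
  move: An; rewrite ler_pdivrMr// DE//.
  have := sqrt_npow_half (R := R) n0; set x := npow (2^-1 - gamma) n; set y := npow _ _ => ny.
  have -> : Num.sqrt n%:R * (d * (x * y)) = Num.sqrt n%:R * y * (x * d) by ring.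
  by rewrite ny mul1r.
Qed.
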